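(* Let $\mathcal{D}_\rho=\big(b_\rho(x)\otimes\tau\,\mathcal{H}^1\llcorner_{\gamma_\rho(x)}\big)_{x\in\mathcal{L}_\rho}$, $\rho>0$, be a sequence of arrays of dislocation loops satisfying assumptions (A1) and (A2). Then there exists a (non-relabelled) subsequence $\rho\to0$ such that $$\lim_{\rho\to0}\mathcal{I}(\mathcal{D}_\rho)=\lim_{\rho\to0}\frac12\sum_{x,y\in\mathcal{L}_\rho,\,x\ne y}f_\rho(x):M(x-y)f_\rho(y).$$
   Context: Elastic kernel. $A:B=\sum_{ij}A_{ij}B_{ij}$. $\mathbb{C}\in\mathrm{Lin}(\mathbb{R}^{3\times3};\mathbb{R}^{3\times3})$, $(\mathbb{C}A)_{ij}=\sum_{kl}\mathbb{C}_{ijkl}A_{kl}$, is an elasticity tensor: $\mathbb{C}F:G=F:\mathbb{C}G$, $\mathbb{C}W=0$ for skew-symmetric $W$, and $\mathbb{C}F:F\ge c|F|^2$ for symmetric $F$, with some $c>0$. $K$ is the $(-1)$-homogeneous Green's function of $\mathcal{L}u=-\operatorname{div}(\mathbb{C}Du)$ on $\mathbb{R}^3$ (row-wise divergence), i.e. $\mathcal{L}(\sum_iK_{ij}e_i)=\delta_0e_j$. The kernel $M$ is the $(-3)$-homogeneous smooth function on $\mathbb{R}^3\setminus\{0\}$ given by $M_{iji'j'}(z)=\sum_{k,l,k',l'}\mathbb{C}_{ijkl}\,\partial_l\partial_{l'}K_{kk'}(z)\,\mathbb{C}_{k'l'i'j'}$; it acts on matrices by $(M(z)A)_{ij}=\sum_{i'j'}M_{iji'j'}(z)A_{i'j'}$.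 Lattice. $v_1,v_2,v_3\in\mathbb{R}^3$ are linearly independent, $\mathcal{L}_1=\{\sum_i\nu_iv_i:\nu_i\in\mathbb{Z}\}$, with unit cell $U=\{\sum_i\alpha_iv_i:\alpha_i\in[0,1]\}$ of Lebesgue measure $1$, and $\mathcal{L}_\rho=\rho\mathcal{L}_1$. Arrays. $\Omega\subseteq\mathbb{R}^3$ is open and bounded. At each $x\in\mathcal{L}_\rho\cap\Omega$ there is a closed oriented $1$-rectifiable loop $\gamma_\rho(x)$ with tangent $\tau$ and Burgers vector $b_\rho(x)\in\mathbb{R}^3$, and an oriented $2$-rectifiable slip surface $S_\rho(x)$ with unit normal $n$ and $\partial S_\rho(x)=\gamma_\rho(x)$; for $x\in\mathcal{L}_\rho\setminus\Omega$ there is no loop ($S_\rho(x)=\emptyset$). The interaction energy of two loops with slip surfaces $S_1,S_2$ with disjoint supports, normals $n_1,n_2$ and Burgers vectors $b_1,b_2$ is $$\mathcal{I}=\int_{S_1}\int_{S_2}(b_1\otimes n_1(x)):M(x-y)(b_2\otimes n_2(y))\,d\mathcal{H}^2(y)\,d\mathcal{H}^2(x),$$ and the total interaction energy is $\mathcal{I}(\mathcal{D}_\rho)=\frac12\sum_{x\ne y\in\mathcal{L}_\rho}\mathcal{I}(\mathcal{D}_\rho(x),\mathcal{D}_\rho(y))$. The oriented surface area function is $f_\rho(x)=\int_{S_\rho(x)}b_\rho\otimes n\,d\mathcal{H}^2\in\mathbb{R}^{3\times3}$, $x\in\mathcal{L}_\rho$. Assumptions. (A1): $\sup_{\rho>0}\sum_{x\in\mathcal{L}_\rho}\rho^{-3}\big(\int_{S_\rho(x)}|b_\rho|\,d\mathcal{H}^2\big)^2<\infty$.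 (A2): $r(\rho):=\operatorname{ess\,sup}_{x\in\mathcal{L}_\rho}\operatorname{ess\,sup}_{y\in S_\rho(x)}|x-y|\in o(\rho)$ as $\rho\to0$ (so for small $\rho$ the slip surfaces have pairwise positive distance). *)

(* Defs.v *)
From HB Require Import structures.
From mathcomp Require Import all_boot all_order all_algebra.
From mathcomp Require Import all_classical all_reals all_analysis ess_sup_inf.

Set Implicit Arguments.
Unset Strict Implicit.
Unset Printing Implicit Defensive.

Import Order.TTheory GRing.Theory Num.Theory.
Import numFieldNormedType.Exports.

Local Open Scope classical_set_scope.
Local Open Scope ring_scope.

(* The library norm on ['rV[R]_n] is the sup norm; the topology does not see
   the difference but the Hausdorff measures do, hence [enorm]. *)
Definition dot (R : realType) n (u v : 'rV[R]_n) : R :=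
  \sum_(i < n) u 0 i * v 0 i.

Definition enorm (R : realType) n (u : 'rV[R]_n) : R := Num.sqrt (dot u u).

Definition frob (R : realType) (A B : 'M[R]_3) : R :=
  \sum_(i < 3) \sum_(j < 3) A i j * B i j.

Definition otimes (R : realType) (b n : 'rV[R]_3) : 'M[R]_3 := b^T *m n.

Section Hausdorff.
Context (R : realType) (n : nat).
Local Open Scope ereal_scope.
Implicit Types (k : nat) (delta : R) (A U : set 'rV[R]_n).

Definition diam U : \bar R :=
  ereal_sup (0 |` [set (enorm (p.1 - p.2))%:E | p in U `*` U]).

(* volume of the unit ball of R^k *)
Fixpoint ball_vol k : R :=
  match k with
  | 0 => 1
  | 1 => 2
  | j.+2 => 2 * pi / j.+2%:R * ball_vol j
  end%R.

(* The normalisation makes the k-dimensional measure agree with area on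
   k-planes; the empty set is singled out only for the sake of [k = 0]. *)
Definition hausdorff_gauge k U : \bar R :=
  if U == set0 then 0 else (ball_vol k / 2 ^+ k)%R%:E * diam U ^+ k.

Definition hausdorff_delta k delta A : \bar R :=
  ereal_inf [set \sum_(i <oo) hausdorff_gauge k (F i) | F in
    [set F : (set 'rV[R]_n)^nat |
      (forall i, diam (F i) <= delta%:E) /\ A `<=` \bigcup_i F i]].

Definition hausdorff k A : \bar R :=
  ereal_sup [set hausdorff_delta k delta A | delta in [set delta | (0 < delta)%R]].

End Hausdorff.

Section Hausdorff_outer_measure.
Context (R : realType) (n : nat).
Local Open Scope ereal_scope.
Implicit Types (k : nat) (delta : R) (A U : set 'rV[R]_n).

Lemma diam_ge0 U : 0 <= diam U.
Proof. by apply: ereal_sup_ubound; left. Qed.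

Lemma diam_set0 : diam (set0 : set 'rV[R]_n) = 0.
Proof.
rewrite /diam (_ : [set _ | _ in _] = set0) ?setU0 ?ereal_sup1//.
by apply/seteqP; split => // x [[a b]] [].
Qed.

Lemma ball_vol_ge0 k : (0 <= ball_vol R k)%R.
Proof.
have [m] := ubnP k; elim: m k => // m IH [|[|k]] //= km.
by rewrite mulr_ge0 ?IH ?divr_ge0 ?mulr_ge0 ?pi_ge0// -ltnS ltnW.
Qed.

Lemma hausdorff_gauge_ge0 k U : 0 <= hausdorff_gauge k U.
Proof.
rewrite /hausdorff_gauge; case: ifP => // _.
by rewrite mule_ge0 ?expe_ge0 ?diam_ge0// lee_fin divr_ge0 ?ball_vol_ge0.
Qed.

Let T := g_sigma_algebraType [set: set 'rV[R]_n].

Let gauge_le k delta (U : set T) : \bar R :=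
  if diam U <= delta%:E then hausdorff_gauge k U else +oo.

Let gauge_le_ge0 k delta (U : set T) : 0 <= gauge_le k delta U.
Proof. by rewrite /gauge_le; case: ifP => // _; exact: hausdorff_gauge_ge0. Qed.

Let gauge_le0 k delta : (0 < delta)%R -> gauge_le k delta set0 = 0.
Proof.
by move=> d0; rewrite /gauge_le diam_set0 lee_fin ltW// /hausdorff_gauge eqxx.
Qed.

Let hausdorff_deltaE k delta A :
  hausdorff_delta k delta A = @mu_ext _ T R (gauge_le k delta) A.
Proof.
apply/eqP; rewrite eq_le; apply/andP; split.
- apply: le_ereal_inf_tmp => _ [F [_ AF] <-].
  have [[i Fi]|/forallNP allF] := pselect (exists i, gauge_le k delta (F i) = +oo).
    rewrite (eseries_pinfty _ _ Fi) ?leey// => j _.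
    by rewrite -ltNye (lt_le_trans _ (gauge_le_ge0 _ _ _)).
  have dF i : diam (F i) <= delta%:E.
    by have := allF i; rewrite /gauge_le; case: ifP.
  apply: ereal_inf_lbound; exists F; first by split.
  by apply: eq_eseriesr => i _; rewrite /gauge_le dF.
- apply: le_ereal_inf_tmp => _ [F [dF AF] <-].
  apply: ereal_inf_lbound; exists F.
    by split=> // i; exact: sub_sigma_algebra.
  by apply: eq_eseriesr => i _; rewrite /gauge_le dF.
Qed.

Lemma hausdorff0 k : hausdorff k (set0 : set 'rV[R]_n) = 0.
Proof.
rewrite /hausdorff (_ : [set _ | _ in _] = [set 0]) ?ereal_sup1//.
have E delta : (0 < delta)%R -> hausdorff_delta k delta (set0 : set 'rV[R]_n) = 0.
  move=> d0; rewrite hausdorff_deltaE mu_ext0//.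
  exact: gauge_le0.
apply/seteqP; split=> [_ [d d0 <-]|_ ->]; first exact: E.
by exists 1%R; rewrite /= ?ltr01//; exact: E.
Qed.

Lemma hausdorff_ge0 k A : 0 <= hausdorff k A.
Proof.
apply: (@le_trans _ _ (hausdorff_delta k 1 A)).
  by rewrite hausdorff_deltaE mu_ext_ge0.
by apply: ereal_sup_ubound; exists 1%R => //=.
Qed.

Lemma le_hausdorff k : {homo @hausdorff R n k : A B / A `<=` B >-> A <= B}.
Proof.
move=> A B AB; apply: ge_ereal_sup => _ [d d0 <-].
apply: (@le_trans _ _ (hausdorff_delta k d B)).
  by rewrite !hausdorff_deltaE; exact: le_mu_ext.
by apply: ereal_sup_ubound; exists d.
Qed.

Lemma hausdorff_sigma_subadditive k : sigma_subadditive (@hausdorff R n k).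
Proof.
move=> F; apply: ge_ereal_sup => _ [d d0 <-].
apply: (@le_trans _ _ (\sum_(i <oo) hausdorff_delta k d (F i))).
  rewrite hausdorff_deltaE; under eq_eseriesr do rewrite hausdorff_deltaE.
  exact: mu_ext_sigma_subadditive.
apply: lee_nneseries => i _.
  by move=> _; rewrite hausdorff_deltaE mu_ext_ge0.
by apply: ereal_sup_ubound; exists d.
Qed.

End Hausdorff_outer_measure.

HB.instance Definition _ (R : realType) (n k : nat) :=
  isOuterMeasure.Build R 'rV[R]_n (@hausdorff R n k)
    (@hausdorff0 R n k) (@hausdorff_ge0 R n k) (@le_hausdorff R n k)
    (@hausdorff_sigma_subadditive R n k).

(* H^k as a measure on the sigma-algebra of H^k-measurable sets *)
Definition Haus (R : realType) (n k : nat) :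
    {measure set (caratheodory_type (@hausdorff R n k)) -> \bar R} :=
  (@hausdorff R n k : {outer_measure set 'rV[R]_n -> \bar R}).
Arguments Haus R {n} k.

Section Calculus.
Context (R : realType).
Implicit Types (f : 'rV[R]_3 -> R) (F : 'rV[R]_3 -> 'rV[R]_3).

Definition partial (i : 'I_3) f : 'rV[R]_3 -> R :=
  fun x => 'D_(delta_mx 0 i) f x.

Definition partials (s : seq 'I_3) f : 'rV[R]_3 -> R := foldr partial f s.

(* C^oo on the open set U *)
Definition smooth_on (U : set 'rV[R]_3) f := forall (s : seq 'I_3) x, U x ->
  {for x, continuous (partials s f)} /\
  forall i : 'I_3, derivable (partials s f) x (delta_mx 0 i).

Definition compactly_supported f :=
  exists B : R, forall x, B < enorm x -> f x = 0.

Definition test_function f := smooth_on setT f /\ compactly_supported f.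

Definition grad f : 'rV[R]_3 -> 'rV[R]_3 := fun x => \row_i partial i f x.

(* index arithmetic is modulo 3 *)
Definition curl F : 'rV[R]_3 -> 'rV[R]_3 := fun x =>
  \row_(i < 3) (partial (i + 1) (fun y => F y 0 (i + 2%:R)) x
              - partial (i + 2%:R) (fun y => F y 0 (i + 1)) x).

Definition vec3 (p : R * R * R) : 'rV[R]_3 :=
  \row_(i < 3) [:: p.1.1; p.1.2; p.2]`_i.

Definition lebesgue3 :
    {measure set (measurableTypeR R * measurableTypeR R * measurableTypeR R)
       -> \bar R} :=
  ((@lebesgue_measure R \x @lebesgue_measure R) \x @lebesgue_measure R)%E.

Definition volume3 (A : set 'rV[R]_3) : \bar R := lebesgue3 (vec3 @^-1` A).

End Calculus.

Section Elasticity.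
Context (R : realType).

Definition tensor4 := 'I_3 -> 'I_3 -> 'I_3 -> 'I_3 -> R.

Definition tapp (T : tensor4) (A : 'M[R]_3) : 'M[R]_3 :=
  \matrix_(i < 3, j < 3) \sum_(k < 3) \sum_(l < 3) T i j k l * A k l.

Definition elasticity_tensor (C : tensor4) :=
  [/\ forall F G, frob (tapp C F) G = frob F (tapp C G),
      forall W, W^T = - W -> tapp C W = 0
    & exists2 c : R, 0 < c &
        forall F, F^T = F -> c * frob F F <= frob (tapp C F) F].

(* The last clause is L (\sum_k K_kj e_k) = delta_0 e_j in the sense of
   distributions, L u = - div (C Du), (Du)_km = d_m u_k; its i-th component is
   tested against phi and both derivatives are moved onto phi. *)
Definition green_function (C : tensor4) (K : 'rV[R]_3 -> 'M[R]_3) :=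
  [/\ forall k j : 'I_3, smooth_on [set z | z != 0] (fun z => K z k j),
      forall (t : R) z, 0 < t -> z != 0 -> K (t *: z) = t^-1 *: K z
    & forall (i j : 'I_3) (phi : 'rV[R]_3 -> R), test_function phi ->
        - (\int[lebesgue3 R]_p
            \sum_(l < 3) \sum_(k < 3) \sum_(m < 3)
               C i l k m * K (vec3 p) k j * partials [:: m; l] phi (vec3 p))
        = (i == j)%:R * phi 0].

Definition elastic_kernel (C : tensor4) (K : 'rV[R]_3 -> 'M[R]_3)
    (z : 'rV[R]_3) : tensor4 := fun i j i' j' =>
  \sum_(k < 3) \sum_(l < 3) \sum_(k' < 3) \sum_(l' < 3)
    C i j k l * partials [:: l; l'] (fun w => K w k k') z * C k' l' i' j'.

End Elasticity.

Section Lattice.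
Context (R : realType).
Implicit Types (v : 'I_3 -> 'rV[R]_3).

Definition lattice v (rho : R) : set 'rV[R]_3 :=
  [set rho *: (\sum_(i < 3) (nu i)%:~R *: v i) | nu in [set: 'I_3 -> int]].

Definition unit_cell v : set 'rV[R]_3 :=
  [set \sum_(i < 3) alpha i *: v i | alpha in
    [set alpha : 'I_3 -> R | forall i, 0 <= alpha i <= 1]].

Definition lattice_basis v :=
  row_free (\matrix_(i < 3) v i) /\ volume3 (unit_cell v) = 1%E.

End Lattice.

Section Rectifiable.
Context (R : realType).
Implicit Types (k : nat) (S P : set 'rV[R]_3).

(* Finite measure is part of the definition, as usual for (k-)rectifiable as
   opposed to countably rectifiable sets. *)
Definition rectifiable k S :=
  [/\ measurable (S : set (caratheodory_type (@hausdorff R 3 k))),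
      (hausdorff k S < +oo)%E
    & exists f : nat -> 'rV[R]_k -> 'rV[R]_3,
        (forall i, [lipschitz f i x | x in setT]) /\
        hausdorff k (S `\` \bigcup_i range (f i)) = 0%E].

(* P is the approximate tangent space of S at x: the blow-ups of H^k |_ S at x
   converge weakly to H^k |_ P. *)
Definition approx_tangent k S (x : 'rV[R]_3) P :=
  forall phi : 'rV[R]_3 -> R, continuous phi -> compactly_supported phi ->
    r ^- k * (\int[Haus R k]_(y in S) phi (r^-1 *: ((y : 'rV[R]_3) - x)))
      @[r --> 0^'+] --> \int[Haus R k]_(y in P) phi y.

(* The field e is H^k-measurable on S and, at H^k-a.e. point of S, it is a unit
   vector for which P (e x) is the approximate tangent space. *)
Definition orients k (P : 'rV[R]_3 -> set 'rV[R]_3) S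
    (e : 'rV[R]_3 -> 'rV[R]_3) :=
  (forall i : 'I_3, measurable_fun (S : set (caratheodory_type (@hausdorff R 3 k)))
                      (fun x : caratheodory_type (@hausdorff R 3 k) => e x 0 i)) /\
  {ae Haus R k, forall x, S x -> enorm (e x) = 1 /\ approx_tangent k S x (P (e x))}.

Definition tangent_field :=
  orients 1 (fun tau => [set t *: tau | t in [set: R]]).

Definition normal_field := orients 2 (fun n => [set y | dot n y = 0]).

End Rectifiable.

Section Dislocations.
Context (R : realType).

Record dislocation_loop := DislocationLoop {
  curve : set 'rV[R]_3;
  tangent : 'rV[R]_3 -> 'rV[R]_3;
  burgers : 'rV[R]_3;
  slip_surface : set 'rV[R]_3;
  slip_normal : 'rV[R]_3 -> 'rV[R]_3 }.

(* Closedness of the curve and "boundary of the slip surface = curve" are meant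
   for the associated multiplicity-one currents; the latter is Stokes' formula. *)
Definition is_dislocation_loop (L : dislocation_loop) :=
  [/\ [/\ rectifiable 1 (curve L),
          tangent_field (curve L) (tangent L)
        & forall phi, test_function phi ->
            (\int[Haus R 1]_(x in curve L) dot (grad phi x) (tangent L x)) = 0],
      rectifiable 2 (slip_surface L) /\
        normal_field (slip_surface L) (slip_normal L)
    & forall F : 'rV[R]_3 -> 'rV[R]_3,
        (forall i, test_function (fun x => F x 0 i)) ->
        (\int[Haus R 2]_(x in slip_surface L) dot (curl F x) (slip_normal L x))
        = (\int[Haus R 1]_(x in curve L) dot (F x) (tangent L x))].

Implicit Types (v : 'I_3 -> 'rV[R]_3) (M : 'rV[R]_3 -> tensor4 R).

Definition interaction M (L1 L2 : dislocation_loop) : R :=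
  \int[Haus R 2]_(x in slip_surface L1) \int[Haus R 2]_(y in slip_surface L2)
    frob (otimes (burgers L1) (slip_normal L1 x))
      (tapp (M ((x : 'rV[R]_3) - (y : 'rV[R]_3)))
            (otimes (burgers L2) (slip_normal L2 y))).

Definition oriented_area (L : dislocation_loop) : 'M[R]_3 :=
  \matrix_(i < 3, j < 3)
    \int[Haus R 2]_(y in slip_surface L)
      otimes (burgers L) (slip_normal L y) i j.

Definition lattice_pairs v rho : set ('rV[R]_3 * 'rV[R]_3) :=
  [set p | [/\ lattice v rho p.1, lattice v rho p.2 & p.1 <> p.2]].

(* In an array all but finitely many terms of these sums vanish, the loops being
   confined to the lattice points of a bounded set. *)
Definition total_interaction v M rho (D : 'rV[R]_3 -> dislocation_loop) : R :=
  2^-1 * \sum_(p \in lattice_pairs v rho) interaction M (D p.1) (D p.2).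

Definition discrete_interaction v M rho (f : 'rV[R]_3 -> 'M[R]_3) : R :=
  2^-1 * \sum_(p \in lattice_pairs v rho)
           frob (f p.1) (tapp (M (p.1 - p.2)) (f p.2)).

Definition dislocation_array v (Omega : set 'rV[R]_3) rho
    (D : 'rV[R]_3 -> dislocation_loop) :=
  (forall x, (lattice v rho `&` Omega) x -> is_dislocation_loop (D x)) /\
  (forall x, (lattice v rho `\` Omega) x ->
     curve (D x) = set0 /\ slip_surface (D x) = set0).

Implicit Types D : R -> 'rV[R]_3 -> dislocation_loop.

Definition square_summable_slip v D :=
  (ereal_sup [set \esum_(x in lattice v rho)
      ((rho ^- 3)%:E *
       (\int[Haus R 2]_(y in slip_surface (D rho x))
          (enorm (burgers (D rho x)))%:E) ^+ 2)
    | rho in [set rho : R | (0 < rho)%R]] < +oo)%E.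

(* The essential supremum over the lattice is a supremum.  Cutting the distance
   off by the indicator of the surface gives the essential supremum over the
   surface, with value 0 when that surface is negligible. *)
Definition slip_radius v D (rho : R) : \bar R :=
  ereal_sup [set ess_sup (Haus R 2)
      (fun y => (enorm (x - (y : 'rV[R]_3)) * \1_(slip_surface (D rho x)) y)%:E)
    | x in lattice v rho].

Definition small_slip_radius v D :=
  forall eps : R, 0 < eps ->
    \forall rho \near 0^'+, (slip_radius v D rho <= (eps * rho)%:E)%E.

End Dislocations.

(* Main.v *)
Require Import Defs.
From mathcomp Require Import all_boot all_order all_algebra all_solvable all_field.
From mathcomp Require Import all_classical all_reals all_analysis.
From mathcomp Require Import measurable_realfun ess_sup_inf.
From mathcomp Require Import complex zify ring lra.

Set Implicit Arguments.
Unset Strict Implicit.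
Unset Printing Implicit Defensive.

Import Order.TTheory GRing.Theory Num.Theory.
Import numFieldNormedType.Exports.

Local Open Scope classical_set_scope.
Local Open Scope ring_scope.

(** The two energies differ by a quantity that tends to 0, and the discrete energy
    stays bounded; a subsequence along which the discrete energy converges then
    serves for both.  Both facts rest on the structure of the elastic kernel M, a
    linear combination of second derivatives of functions that are smooth off the
    origin and homogeneous of degree -1.

    Difference of the energies.  On the slip surfaces of the loops at x and y, off
    H^2-null sets, the kernel M(x' - y') deviates from M(x - y) by at most a
    multiple of r |x - y|^-4, where r is the slip radius
    ([interaction_near_point]).  Since |z|^-4 is summable over the lattice, a
    Schur test bounds the sum over all pairs by r rho^-4 times the sum of the
    squared masses of the slip surfaces; as these squares are summable with sum
    O(rho^3), this is a multiple of r / rho, which vanishes because the slip radius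
    is o(rho) ([energies_close]).  To split the double integrals one
    needs x' |-> M(x' - y') to be measurable for the Caratheodory sigma-algebra of
    H^2, that is, Borel sets to be measurable: the Hausdorff measure is a metric
    outer measure ([open_measurable_hausdorff]).

    Boundedness.  The kernel |z|^-3 is not summable, so cancellation is needed: the
    discrete energy is controlled by the l^2 norm of the oriented areas because M
    restricted to the lattice is a discrete Calderon-Zygmund kernel
    ([elastic_kernel_bilinear], [discrete_interaction_bounded]).  No integral
    enters this bound.  Expanding the outer derivative of M = d_l g in the lattice
    basis turns it into lattice differences of g up to O(|z|^-4)
    ([partial_cz_kernel]).  For a kernel a with |a| <= c |z|^-3, differences
    bounded by c |z|^-4 and a = (difference of a potential of size |z|^-2) +
    O(|z|^-4), the Fourier symbol is bounded ([cz_symbol_bound]): if theta is the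
    distance of the frequency from 0, the part |z| <= 1/theta is summed by parts
    onto the character, whose increments are O(theta) while the sum of the potential
    is O(1/theta), and the part |z| > 1/theta is summed by parts onto the kernel,
    whose differences sum up to O(theta), at the cost of a factor 1/theta. As all
    sums are finite, the Fourier transform is that of a finite group (Z/P)^3 with
    P large, and Plancherel's identity yields the l^2 bound ([cz_bilinear_bound]).
    *)

(** * Lattice boxes and radial sums *)

Notation Z3 := 'rV[int]_3.

(** The sup norm makes the balls boxes, whose cardinals are cubes. *)
Definition lat_norm (z : Z3) : nat := \max_(i < 3) `|z 0%R i|%N.

Definition lat_basis (i : 'I_3) : Z3 := delta_mx 0 i.

Lemma lat_norm_le (z : Z3) n :
  (lat_norm z <= n)%N <-> forall i, (`|z 0%R i| <= n)%N.
Proof.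
rewrite /lat_norm; split=> [/bigmax_leqP zn i|zn]; first exact: zn.
by apply/bigmax_leqP.
Qed.

Lemma lat_norm_ge (z : Z3) i : (`|z 0%R i| <= lat_norm z)%N.
Proof. exact: (leq_bigmax i). Qed.

Lemma lat_norm0 : lat_norm 0 = 0%N.
Proof. by apply/eqP; rewrite -leqn0; apply/lat_norm_le => i; rewrite mxE. Qed.

Lemma lat_norm_eq0 z : (lat_norm z == 0%N) = (z == 0).
Proof.
apply/eqP/eqP => [z0|->]; last exact: lat_norm0.
apply/rowP => i; rewrite mxE; apply/eqP; rewrite -absz_eq0 -leqn0.
by apply: leq_trans (lat_norm_ge z i) _; rewrite z0.
Qed.

Lemma lat_normN z : lat_norm (- z) = lat_norm z.
Proof. by apply: eq_bigr => i _; rewrite mxE abszN. Qed.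

Lemma absz_leD (a b : int) : (`|(a + b)%R| <= `|a| + `|b|)%N.
Proof. lia. Qed.

Lemma lat_normD (y z : Z3) : (lat_norm (y + z) <= lat_norm y + lat_norm z)%N.
Proof.
apply/lat_norm_le => i; rewrite mxE.
by apply: leq_trans (absz_leD _ _) _; rewrite leq_add ?lat_norm_ge.
Qed.

Lemma lat_normB (y z : Z3) : (lat_norm (y - z) <= lat_norm y + lat_norm z)%N.
Proof. by rewrite -(lat_normN z) lat_normD. Qed.

Lemma lat_norm_basis i : lat_norm (lat_basis i) = 1%N.
Proof.
apply/eqP; rewrite eqn_leq; apply/andP; split.
  by apply/lat_norm_le => j; rewrite mxE eqxx /=; case: eqP.
by apply: leq_trans (lat_norm_ge _ i); rewrite mxE !eqxx.
Qed.

Lemma lat_norm_subb (z : Z3) i : (lat_norm (z - lat_basis i)%R <= (lat_norm z).+1)%N.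
Proof. by have := lat_normB z (lat_basis i); rewrite lat_norm_basis addn1. Qed.

Lemma lat_norm_leS (z : Z3) i : (lat_norm z <= (lat_norm (z - lat_basis i)%R).+1)%N.
Proof.
by have := lat_normD (z - lat_basis i) (lat_basis i); rewrite subrK lat_norm_basis addn1.
Qed.

Definition box_point n (k : {ffun 'I_3 -> 'I_n.*2.+1}) : Z3 :=
  \row_i ((k i)%:Z - n%:Z).

Definition box n : seq Z3 := [seq box_point k | k : {ffun 'I_3 -> 'I_n.*2.+1}].

Lemma box_uniq n : uniq (box n).
Proof.
rewrite map_inj_uniq ?enum_uniq// => k l /rowP kl.
apply/ffunP => i; apply/val_inj => /=; have := kl i; rewrite !mxE.
by move/addIr => [].
Qed.

Lemma mem_box n z : (z \in box n) = (lat_norm z <= n)%N.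
Proof.
apply/mapP/idP => [[k _ ->]|zn].
  have bnd (a : nat) : (a < n.*2.+1)%N -> (`|(a%:Z - n%:Z)%R| <= n)%N by lia.
  by apply/lat_norm_le => i; rewrite mxE bnd.
have bnd (a : int) : (`|a| <= n)%N -> (`|(a + n%:Z)%R| < n.*2.+1)%N by lia.
have zi i : (`|(z 0%R i + n%:Z)%R| < n.*2.+1)%N.
  by apply: bnd; exact: leq_trans (lat_norm_ge z i) zn.
have bndK (a : int) : (`|a| <= n)%N -> a = (`|(a + n%:Z)%R|%N : int) - n%:Z by lia.
exists [ffun i => Ordinal (zi i)]; first by rewrite mem_enum.
apply/rowP => i; rewrite !mxE ffunE /=.
by apply: bndK; exact: leq_trans (lat_norm_ge z i) zn.
Qed.

Lemma size_box n : size (box n) = (n.*2.+1 ^ 3)%N.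
Proof. by rewrite size_map -cardE card_ffun !card_ord. Qed.

Section LatticeSums.
Variable V : zmodType.
Implicit Types F : Z3 -> V.

(** Finite sums over boxes behave as sums over all of Z^3 as long as the summand
    is supported in the box; this gives the translation invariance below. *)
Lemma eq_sum_support (s t : seq Z3) F : uniq s -> uniq t ->
  (forall z, F z != 0 -> (z \in s) && (z \in t)) ->
  \sum_(z <- s) F z = \sum_(z <- t) F z.
Proof.
move=> us ut Fst.
have E r : \sum_(z <- r) F z = \sum_(z <- [seq z <- r | F z != 0]) F z.
  rewrite big_filter (bigID (fun z => F z != 0)) /= [X in _ + X]big1 ?addr0//.
  by move=> z /negPn/eqP.
rewrite E [RHS]E; apply: perm_big; apply: uniq_perm; rewrite ?filter_uniq//.
move=> z; rewrite !mem_filter.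
by case: eqP => //= /eqP/Fst/andP[-> ->].
Qed.

Lemma sum_box_shift m F e :
  (forall z, F z != 0 -> (z \in box m) && (z - e \in box m)) ->
  \sum_(z <- box m) F (z + e) = \sum_(z <- box m) F z.
Proof.
move=> Fm.
rewrite -(big_map (fun z => z + e) xpredT F); apply: eq_sum_support => [||z /Fm].
- by rewrite map_inj_uniq ?box_uniq//; exact: addIr.
- exact: box_uniq.
move=> /andP[zm zem]; rewrite zm andbT; apply/mapP; exists (z - e) => //.
by rewrite subrK.
Qed.

Lemma sum_box_le r n F : (r <= n)%N ->
  \sum_(z <- box n | (lat_norm z <= r)%N) F z = \sum_(z <- box r) F z.
Proof.
move=> rn; rewrite -big_filter; apply: perm_big; apply: uniq_perm.
- by rewrite filter_uniq ?box_uniq.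
- exact: box_uniq.
move=> z; rewrite mem_filter !mem_box andbC.
by case: leqP => //= h; apply/esym/negbTE; rewrite -ltnNge (leq_ltn_trans rn).
Qed.

End LatticeSums.

Section RadialSums.
Variable R : realType.
Implicit Types (p : pred nat) (g : nat -> R).

Definition weight (r : nat) : R := r.+1%:R.

Lemma weight_gt0 r : 0 < weight r. Proof. exact: ltr0Sn. Qed.
Lemma weight_ge0 r : 0 <= weight r. Proof. exact: ler0n. Qed.
Lemma weight_ge1 r : 1 <= weight r. Proof. by rewrite ler1n. Qed.
Lemma weight_neq0 r : weight r != 0. Proof. by rewrite gt_eqF ?weight_gt0. Qed.

(** A shell is the difference of two boxes, and (2r+1)^3 - (2r-1)^3 = 24 r^2 + 2; the
    factor (r+1)^2 in place of r^2 is there for the shell reduced to the origin. *)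
Lemma shell_count n r :
  (count (fun z => lat_norm z == r) (box n) <= 26 * r.+1 ^ 2)%N.
Proof.
have [rn|nr] := leqP r n; last first.
  rewrite (@eq_in_count _ _ pred0) ?count_pred0// => z; rewrite mem_box => zn /=.
  by apply/negbTE; rewrite neq_ltn (leq_ltn_trans zn).
have E m : (m <= n)%N -> count (fun z => (lat_norm z <= m)%N) (box n) = size (box m).
  move=> mn; rewrite -size_filter; apply/perm_size/uniq_perm.
  - by rewrite filter_uniq ?box_uniq.
  - exact: box_uniq.
  move=> z; rewrite mem_filter !mem_box; case: leqP => //= h.
  by rewrite (leq_trans h).
case: r rn => [|r] rn.
  have -> : count (fun z => lat_norm z == 0%N) (box n) = size (box 0).
    by rewrite -(E 0%N) //; apply: eq_count => z /=; rewrite leqn0.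
  by rewrite size_box.
have := E _ rn; have := E _ (ltnW rn); rewrite !size_box => Er Er1.
have : (count (fun z => lat_norm z <= r.+1)%N (box n) =
  count (fun z => lat_norm z <= r)%N (box n) +
  count (fun z => lat_norm z == r.+1)%N (box n))%N.
  rewrite -count_predUI.
  rewrite (@eq_count _ (predI _ _) pred0) ?count_pred0 ?addn0.
    by apply: eq_count => z /=; rewrite leq_eqVlt ltnS orbC.
  by move=> z /=; case: eqP => [->|_]; rewrite ?ltnn ?andbF.
rewrite Er Er1; lia.
Qed.

(** Passage to polar coordinates. *)
Lemma radial_sum_le p g n : (forall r, 0 <= g r) ->
  \sum_(z <- box n | p (lat_norm z)) g (lat_norm z) <=
  \sum_(0 <= r < n.+1 | p r) 26%:R * (weight r ^+ 2 * g r).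
Proof.
move=> g0; rewrite big_mkcond /=.
have -> : \sum_(z <- box n) (if p (lat_norm z) then g (lat_norm z) else 0) =
    \sum_(z <- box n) \sum_(0 <= r < n.+1 | p r) (lat_norm z == r)%:R * g r.
  rewrite !big_seq; apply: eq_bigr => z; rewrite mem_box => zn.
  rewrite [RHS]big_mkcond /= (bigD1_seq (lat_norm z)) ?mem_index_iota ?iota_uniq//=.
  rewrite eqxx mul1r big1 ?addr0// => i /negbTE iz.
  by rewrite eq_sym iz mul0r; case: ifP.
rewrite exchange_big /=; apply: ler_sum => r _.
rewrite -mulr_suml mulrA ler_wpM2r//.
have -> : \sum_(z <- box n) (lat_norm z == r)%:R =
    (count (fun z => lat_norm z == r) (box n))%:R :> R.
  by rewrite -sum1_count natr_sum [RHS]big_mkcond; apply: eq_bigr => z _; case: eqP.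
by rewrite /weight -natrX -natrM ler_nat shell_count.
Qed.
Lemma shell_sum_le g n r : (forall r, 0 <= g r) ->
  \sum_(z <- box n | lat_norm z == r) g (lat_norm z) <=
  26%:R * (weight r ^+ 2 * g r).
Proof.
move=> g0; apply: le_trans (radial_sum_le (pred1 r) n g0) _.
have [rn|nr] := boolP (r \in index_iota 0 n.+1).
  rewrite big_mkcond (bigD1_seq r) ?iota_uniq//= eqxx big1 ?addr0//.
  by move=> i /negbTE; rewrite eq_sym => ->.
rewrite big_seq_cond big1 ?mulr_ge0 ?exprn_ge0 ?weight_ge0//.
by move=> i /andP[+ /eqP ir]; rewrite ir (negbTE nr).
Qed.

(** Comparison with the telescoping sum of 1/r - 1/(r+1). *)
Lemma sum_weightV2_tail m n :
  \sum_(0 <= r < n.+1 | (m < r)%N) weight r ^- 2 <= (weight m)^-1.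
Proof.
suff : \sum_(0 <= r < n.+1 | (m < r)%N) weight r ^- 2 <=
    if (m < n)%N then (weight m)^-1 - (weight n)^-1 else 0.
  move=> /le_trans; apply; case: ifP => _; rewrite ?invr_ge0 ?weight_ge0//.
  by rewrite lerBlDr lerDl invr_ge0 weight_ge0.
elim: n => [|n IH]; first by rewrite big_mkcond big_nat1.
rewrite big_mkcond big_nat_recr //= -big_mkcond /=.
have H k : weight k.+1 ^- 2 <= (weight k)^-1 - (weight k.+1)^-1.
  rewrite /weight -[in leRHS]mulN1r.
  have k0 : k.+1%:R != 0 :> R by rewrite pnatr_eq0.
  have k1 : k.+2%:R != 0 :> R by rewrite pnatr_eq0.
  have -> : (k.+1%:R)^-1 + -1 * k.+2%:R^-1 = (k.+1%:R * k.+2%:R)^-1 :> R.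
    move: k0 k1; rewrite -(natr1 k.+1); move: k.+1%:R => a a0 a1.
    by field; apply/andP; split.
  by rewrite lef_pV2 ?posrE ?exprn_gt0 ?mulr_gt0 ?ltr0Sn// expr2 ler_pM2r ?ltr0Sn// ler_nat.
rewrite ltnS; case: (ltngtP m n) IH => [mn|nm|->] IH.
- by apply: le_trans (lerD IH (H n)) _; rewrite addrA subrK.
- by rewrite addr0.
- by apply: le_trans (lerD IH (H n)) _; rewrite add0r.
Qed.

Lemma sum_weightV2 n : \sum_(0 <= r < n.+1) weight r ^- 2 <= 2.
Proof.
rewrite big_nat_recl// [X in _ + X](_ : _ = \sum_(0 <= r < n.+1 | (0 < r)%N) weight r ^- 2).
  by have := sum_weightV2_tail 0 n; rewrite /weight expr1n invr1; lra.
by rewrite [RHS]big_mkcond big_nat_recl//= add0r.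
Qed.

Let wV_ge0 k r : 0 <= weight r ^- k.
Proof. by rewrite invr_ge0 exprn_ge0 ?weight_ge0. Qed.

Let wV24 r : weight r ^+ 2 * weight r ^- 4 = weight r ^- 2.
Proof. by have := weight_neq0 r => ?; field. Qed.

Lemma tail_sum_weightV4 m n :
  \sum_(z <- box n | (m < lat_norm z)%N) weight (lat_norm z) ^- 4 <=
  26%:R * (weight m)^-1.
Proof.
apply: le_trans (radial_sum_le _ n (wV_ge0 4)) _.
under eq_bigr do rewrite wV24.
by rewrite -mulr_sumr ler_wpM2l// sum_weightV2_tail.
Qed.

Lemma ball_sum_weightV4 n :
  \sum_(z <- box n) weight (lat_norm z) ^- 4 <= 52%:R.
Proof.
apply: le_trans (radial_sum_le xpredT n (wV_ge0 4)) _.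
under eq_bigr do rewrite wV24.
by rewrite -mulr_sumr; have := sum_weightV2 n; lra.
Qed.

Lemma ball_sum_weightV2 n :
  \sum_(z <- box n) weight (lat_norm z) ^- 2 <= 26%:R * weight n.
Proof.
apply: le_trans (radial_sum_le xpredT n (wV_ge0 2)) _.
under eq_bigr do rewrite divff ?expf_neq0 ?weight_neq0//.
by rewrite -mulr_sumr sumr_const_nat subn0.
Qed.

End RadialSums.

(** * Summation by parts against characters *)

Section ComplexModulus.
Variable R : realType.
Local Notation normc := (@Normc.normc R).

Lemma normc_ge0 (x : R[i]) : 0 <= normc x.
Proof. by case: x => a b; rewrite sqrtr_ge0. Qed.

Lemma normc_real (x : R) : normc (x%:C)%C = `|x|.
Proof. by rewrite /Normc.normc /= expr0n /= addr0 sqrtr_sqr. Qed.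

Lemma ler_normc_sum I (s : seq I) (P : pred I) (F : I -> R[i]) :
  normc (\sum_(i <- s | P i) F i) <= \sum_(i <- s | P i) normc (F i).
Proof.
elim/big_ind2 : _ => //; first by rewrite Normc.normc0.
by move=> x1 x2 y1 y2 h1 h2; apply: le_trans (le_normcD _ _) _; rewrite lerD.
Qed.

Lemma normcX (x : R[i]) n : normc (x ^+ n) = normc x ^+ n.
Proof.
by elim: n => [|n IH]; rewrite ?Normc.normc1// !exprS Normc.normcM IH.
Qed.

Lemma ler_normcB (x y : R[i]) : normc (x - y) <= normc x + normc y.
Proof. by apply: le_trans (le_normcD _ _) _; rewrite normcN. Qed.

Lemma normc_unit_neq0 (u : R[i]) : normc u = 1 -> u != 0.
Proof.
by move=> u1; apply/eqP => u0; move: u1; rewrite u0 Normc.normc0 => /eqP; rewrite eq_sym oner_eq0.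
Qed.

Lemma normcXz (u : R[i]) (k : int) : normc u = 1 -> normc (u ^ k) = 1.
Proof.
move=> u1; case: k => n; rewrite ?NegzE.
  by rewrite -exprnP normcX u1 expr1n.
by rewrite -exprnN Normc.normcV normcX u1 expr1n invr1.
Qed.

End ComplexModulus.

Section Characters.
Variable R : realType.
Local Notation normc := (@Normc.normc R).
Implicit Types (u : 'I_3 -> R[i]) (z : Z3).

Definition char3 u z : R[i] := \prod_(i < 3) u i ^ z 0 i.

Lemma char3D u y z : (forall i, u i != 0) ->
  char3 u (y + z) = char3 u y * char3 u z.
Proof.
by move=> u0; rewrite -big_split; apply: eq_bigr => i _; rewrite mxE expfzDr.
Qed.

Lemma char3_basis u i : char3 u (lat_basis i) = u i.
Proof.
rewrite /char3 (bigD1 i)//= mxE !eqxx big1 ?mulr1// => j /negbTE ji.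
by rewrite mxE ji andbF.
Qed.

Lemma normc_char3 u z : (forall i, normc (u i) = 1) -> normc (char3 u z) = 1.
Proof.
move=> u1; rewrite /char3; elim/big_ind : _ => [|x y x1 y1|i _].
- exact: Normc.normc1.
- by rewrite Normc.normcM x1 y1 mulr1.
- exact: normcXz.
Qed.

End Characters.

Section SummationByParts.
Variable R : realType.
Local Notation normc := (@Normc.normc R).

Lemma ler_sum_shells (g : nat -> R) n (ts : seq nat) : (forall r, 0 <= g r) ->
  \sum_(z <- box n | lat_norm z \in ts) g (lat_norm z) <=
  \sum_(t <- ts) 26%:R * (weight R t ^+ 2 * g t).
Proof.
move=> g0; elim: ts => [|t ts IH]; first by rewrite big_nil big1.
rewrite big_cons; apply: le_trans (lerD (shell_sum_le n t g0) IH).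
rewrite [X in _ <= X + _]big_mkcond [X in _ <= _ + X]big_mkcond -big_split /=.
rewrite big_mkcond /=; apply: ler_sum => z _; rewrite inE.
by case: eqP => _; case: ifP => _ //=; rewrite ?addr0 ?add0r ?lerDl.
Qed.

(** The cut-off p enters the right-hand side together with alpha, so that its jumps
    produce the boundary terms. *)
Lemma sum_by_parts n (p : pred nat) i (alpha beta : Z3 -> R[i]) :
  (forall r, p r -> (r <= n)%N) ->
  \sum_(z <- box n | p (lat_norm z)) alpha z * (beta (z + lat_basis i) - beta z) =
  \sum_(z <- box n.+1) beta z *
     ((p (lat_norm (z - lat_basis i)))%:R * alpha (z - lat_basis i) -
      (p (lat_norm z))%:R * alpha z).
Proof.
move=> pn; set e := lat_basis i.
pose F z := (p (lat_norm (z - e)))%:R * alpha (z - e) * beta z.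
transitivity (\sum_(z <- box n.+1) (F (z + e) - (p (lat_norm z))%:R * alpha z * beta z)).
  rewrite big_mkcond /=.
  rewrite (@eq_sum_support _ (box n) (box n.+1)) ?box_uniq//.
    by apply: eq_bigr => z _; rewrite /F addrK; case: ifP; rewrite ?mul1r ?mul0r ?subr0 ?mulrBr.
  by move=> z; rewrite !mem_box; case: ifP => [/pn zn _|_]; rewrite ?eqxx// zn (leq_trans zn).
rewrite sumrB sum_box_shift.
  by rewrite -sumrB; apply: eq_bigr => z _; rewrite /F -mulrBl mulrC.
move=> z; rewrite /F !mem_box; case: (boolP (p _)) => [/pn zn _|]; last by rewrite !mul0r eqxx.
by rewrite (leq_trans (lat_norm_leS z i))//= ?(leq_trans zn).
Qed.

(** The boundary terms live on the radii adjacent to a jump of p, which q has to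
    contain; the bounds are radial so that the sums can be evaluated shell by
    shell. *)
Lemma ler_sum_by_parts n (p q : pred nat) i (alpha beta : Z3 -> R[i])
    (a a' b : nat -> R) :
  (forall r, p r -> (r <= n)%N) ->
  (forall s t, (s <= t.+1)%N -> (t <= s.+1)%N -> p s != p t -> q t) ->
  (forall z, normc (alpha z) <= a (lat_norm z)) ->
  (forall z, normc (alpha (z - lat_basis i)) <= a (lat_norm z)) ->
  (forall z, normc (alpha (z - lat_basis i) - alpha z) <= a' (lat_norm z)) ->
  (forall z, normc (beta z) <= b (lat_norm z)) ->
  normc (\sum_(z <- box n | p (lat_norm z))
            alpha z * (beta (z + lat_basis i) - beta z)) <=
  \sum_(z <- box n.+1 | q (lat_norm z)) a (lat_norm z) * b (lat_norm z) +
  \sum_(z <- box n | p (lat_norm z)) a' (lat_norm z) * b (lat_norm z).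
Proof.
move=> pn pq aP aeP a'P bP; rewrite sum_by_parts//.
apply: le_trans (ler_normc_sum _ _ _) _.
have b0 z : 0 <= b (lat_norm z) by apply: le_trans (bP z); exact: normc_ge0.
have a0 z : 0 <= a (lat_norm z) by apply: le_trans (aP z); exact: normc_ge0.
have a'0 z : 0 <= a' (lat_norm z) by apply: le_trans (a'P z); exact: normc_ge0.
have -> : \sum_(z <- box n | p (lat_norm z)) a' (lat_norm z) * b (lat_norm z) =
    \sum_(z <- box n.+1 | p (lat_norm z)) a' (lat_norm z) * b (lat_norm z).
  rewrite big_mkcond [RHS]big_mkcond; apply: eq_sum_support; rewrite ?box_uniq//.
  move=> z; rewrite !mem_box; case: ifP => [/pn zn _|]; last by rewrite eqxx.
  by rewrite zn (leq_trans zn).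
rewrite [X in _ <= X + _]big_mkcond [X in _ <= _ + X]big_mkcond -big_split /=.
apply: ler_sum => z _; rewrite Normc.normcM mulrC.
set y := z - _.
have nM x r : normc x <= r -> normc x * normc (beta z) <= r * b (lat_norm z).
  by move=> xr; apply: ler_pM => //; exact: normc_ge0.
have := pq (lat_norm y) (lat_norm z) (lat_norm_subb _ _) (lat_norm_leS _ _).
case: (p (lat_norm y)); case: (p (lat_norm z)) => /= pqz.
- rewrite !mul1r -[leLHS]add0r lerD//.
    by case: ifP => _ //; rewrite mulr_ge0.
  by apply: nM; exact: a'P.
- by rewrite pqz// mul1r mul0r subr0 addr0 nM ?aeP.
- rewrite pqz// mul1r mul0r sub0r normcN.
  by rewrite -[leLHS]addr0 lerD ?mulr_ge0// nM.
- by rewrite !mul0r subrr Normc.normc0 mul0r addr0; case: ifP => _ //; rewrite mulr_ge0.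
Qed.

End SummationByParts.

(** * The symbol of a discrete Calderon-Zygmund kernel *)

(** A discrete Calderon-Zygmund kernel.  The usual size and smoothness conditions
    are complemented by the fourth one, which stands in for the vanishing mean over
    spheres: up to a summable error, a is a discrete divergence, so that its sums
    over boxes telescope to boundary terms of size r^2 r^-2. *)
Record cz_kernel (R : realType) (c : R) (a : Z3 -> R) (G : 'I_3 -> Z3 -> R) := {
  cz_size : forall z, `|a z| <= c * weight R (lat_norm z) ^- 3;
  cz_smooth : forall i z,
    `|a (z - lat_basis i) - a z| <= c * weight R (lat_norm z) ^- 4;
  cz_potential : forall i z, `|G i z| <= c * weight R (lat_norm z) ^- 2;
  cz_cancel : forall z, `|a z - \sum_(i < 3) (G i (z + lat_basis i) - G i z)| <=
    c * weight R (lat_norm z) ^- 4 }.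

Section Symbol.
Variables (R : realType) (c : R) (a : Z3 -> R) (G : 'I_3 -> Z3 -> R).
Hypothesis aG : cz_kernel c a G.
Variable u : 'I_3 -> R[i].
Local Notation normc := (@Normc.normc R).
Hypothesis u1 : forall i, normc (u i) = 1.

Let u0 i : u i != 0. Proof. exact: normc_unit_neq0. Qed.

Let c0 : 0 <= c.
Proof.
have := le_trans (normr_ge0 _) (cz_size aG 0).
by rewrite lat_norm0 /weight expr1n invr1 mulr1.
Qed.

Let wV_ge0 k r : 0 <= weight R r ^- k.
Proof. by rewrite invr_ge0 exprn_ge0 ?weight_ge0. Qed.

Let char3_sub_basis i z :
  normc (char3 u (z - lat_basis i) - char3 u z) = normc (u i - 1).
Proof.
have -> : char3 u z = char3 u (z - lat_basis i) * u i.
  by rewrite -(char3_basis u i) -char3D// subrK.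
rewrite -{1}[char3 u _]mulr1.
by rewrite -mulrBr Normc.normcM normc_char3// mul1r -normcN opprB.
Qed.

(** Near the origin the difference is moved from the potential to the character,
    whose increments are bounded by |u_i - 1|: the boundary costs O(1) and the
    interior |u_i - 1| times the sum of |z|^-2, of order r. *)
Let near_potential i r :
  normc (\sum_(z <- box r) char3 u z * ((G i (z + lat_basis i))%:C%C - (G i z)%:C%C))
  <= 52%:R * c + 26%:R * c * (normc (u i - 1) * weight R r).
Proof.
have -> : \sum_(z <- box r) char3 u z * ((G i (z + lat_basis i))%:C%C - (G i z)%:C%C) =
    \sum_(z <- box r | (lat_norm z <= r)%N)
      char3 u z * ((G i (z + lat_basis i))%:C%C - (G i z)%:C%C).
  by rewrite sum_box_le.
apply: le_trans (@ler_sum_by_parts R r (fun s => s <= r)%N (fun s => s \in [:: r; r.+1])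
  i (char3 u) (fun z => (G i z)%:C%C) (fun=> 1) (fun=> normc (u i - 1))
  (fun s => c * weight R s ^- 2) _ _ _ _ _ _) _ => //.
- by move=> s t st ts; rewrite !inE; case: leqP; case: leqP => //; lia.
- by move=> z; rewrite normc_char3.
- by move=> z; rewrite normc_char3.
- by move=> z; rewrite char3_sub_basis.
- by move=> z; rewrite normc_real (cz_potential aG).
apply: lerD.
  under eq_bigr do rewrite mul1r.
  apply: le_trans (@ler_sum_shells R (fun s => c * weight R s ^- 2) _ _ _) _.
    by move=> s; rewrite mulr_ge0.
  rewrite !big_cons big_nil addr0.
  have w2 s : weight R s ^+ 2 * (c * weight R s ^- 2) = c.
    by rewrite mulrCA divff ?mulr1 ?expf_neq0 ?weight_neq0.
  by rewrite !w2 -mulrDl -natrD.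
rewrite sum_box_le// -!mulr_sumr.
have /(ler_wpM2l (mulr_ge0 (normc_ge0 (u i - 1)) c0)) := ball_sum_weightV2 R r.
by rewrite -!mulrA => /le_trans; apply; rewrite le_eqVlt; apply/orP; left; apply/eqP; ring.
Qed.

Let near t r : (forall i, normc (u i - 1) <= t) ->
  normc (\sum_(z <- box r) char3 u z * (a z)%:C%C) <=
  208%:R * c + 78%:R * c * (t * weight R r).
Proof.
move=> ut.
pose E z := a z - \sum_(i < 3) (G i (z + lat_basis i) - G i z).
have -> : \sum_(z <- box r) char3 u z * (a z)%:C%C =
    \sum_(z <- box r) char3 u z * (E z)%:C%C +
    \sum_(i < 3) \sum_(z <- box r) char3 u z *
        ((G i (z + lat_basis i))%:C%C - (G i z)%:C%C).
  rewrite exchange_big -big_split; apply: eq_bigr => z _ /=.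
  rewrite -mulr_sumr -mulrDr; congr (_ * _).
  rewrite /E rmorphB rmorph_sum /=; under [X in _ - X]eq_bigr do rewrite rmorphB.
  by rewrite subrK.
apply: le_trans (le_normcD _ _) _.
have -> : 208%:R * c + 78%:R * c * (t * weight R r) =
    52%:R * c + \sum_(i < 3) (52%:R * c + 26%:R * c * (t * weight R r)).
  by rewrite !big_ord_recr big_ord0 /=; ring.
apply: lerD.
  apply: le_trans (ler_normc_sum _ _ _) _.
  apply: le_trans (_ : _ <= \sum_(z <- box r) c * weight R (lat_norm z) ^- 4) _.
    apply: ler_sum => z _; rewrite Normc.normcM normc_char3// mul1r normc_real.
    exact: (cz_cancel aG).
  by rewrite -mulr_sumr mulrC ler_wpM2r// ball_sum_weightV4.
apply: le_trans (ler_normc_sum _ _ _) _; apply: ler_sum => i _.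
apply: le_trans (near_potential _ _) _.
rewrite lerD2l ler_wpM2l ?mulr_ge0//.
by rewrite ler_wpM2r ?weight_ge0.
Qed.

(** Away from the origin the character is written as a difference, at the price
    of the factor u_i - 1, and the difference is moved to the kernel, where it gains
    one power of |z|: what remains is of order 1/r. *)
Let far i r n : (r <= n)%N ->
  normc (u i - 1) *
  normc (\sum_(z <- box n | (r < lat_norm z)%N) char3 u z * (a z)%:C%C) <=
  234%:R * c * (weight R r)^-1.
Proof.
move=> rn; rewrite -Normc.normcM mulr_sumr.
pose p s := (r < s <= n)%N.
have -> : \sum_(z <- box n | (r < lat_norm z)%N) (u i - 1) * (char3 u z * (a z)%:C%C) =
  \sum_(z <- box n | p (lat_norm z)) (a z)%:C%C * (char3 u (z + lat_basis i) - char3 u z).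
  rewrite big_seq_cond [RHS]big_seq_cond; apply: eq_big => [z|z _].
    by rewrite /p mem_box; case: (leqP _ n); rewrite ?andbT ?andbF.
  by rewrite char3D// char3_basis; ring.
apply: le_trans (@ler_sum_by_parts R n p (fun s => s \in [:: r; r.+1; n; n.+1])
  i (fun z => (a z)%:C%C) (char3 u) (fun s => 2 * c * weight R s ^- 3)
  (fun s => c * weight R s ^- 4)
  (fun=> 1) _ _ _ _ _ _) _ => //.
- by move=> s /andP[].
- move=> s t st ts; rewrite !inE /p.
  by move=> h; apply/negPn/negP => h'; move: h; apply/negP/negPn/eqP; move: h'; lia.
- move=> z; rewrite normc_real; apply: le_trans (cz_size aG z) _.
  by rewrite ler_wpM2r// ler_peMl// ler1n.
- move=> z; rewrite normc_real.
  have -> : a (z - lat_basis i) = (a (z - lat_basis i) - a z) + a z by rewrite subrK.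
  apply: le_trans (ler_normD _ _) _.
  apply: le_trans (lerD (cz_smooth aG i z) (cz_size aG z)) _.
  rewrite -mulrA mulr2n mulrDl mul1r lerD// ler_wpM2l//.
  by rewrite lef_pV2 ?posrE ?exprn_gt0 ?weight_gt0// ler_weXn2l ?weight_ge1.
- by move=> z; rewrite -rmorphB normc_real; exact: (cz_smooth aG).
- by move=> z; rewrite normc_char3.
have w0 s : 0 <= weight R s by exact: weight_ge0.
apply: le_trans (_ : _ <= 208%:R * c * (weight R r)^-1 + 26%:R * c * (weight R r)^-1) _;
  last by rewrite -!mulrDl -natrD.
apply: lerD.
  under eq_bigr do rewrite mulr1.
  apply: le_trans (@ler_sum_shells R (fun s => 2 * c * weight R s ^- 3) _ _ _) _.
    by move=> s; rewrite !mulr_ge0.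
  have w2 s : (r <= s)%N -> 26%:R * (weight R s ^+ 2 * (2 * c * weight R s ^- 3)) <=
      52%:R * c * (weight R r)^-1.
    move=> rs.
    have -> : 26%:R * (weight R s ^+ 2 * (2 * c * weight R s ^- 3)) =
        52%:R * c * (weight R s)^-1.
      by have := weight_neq0 R s => ?; field.
    rewrite ler_wpM2l ?mulr_ge0// lef_pV2 ?posrE ?weight_gt0//.
    by rewrite ler_nat ltnS.
  rewrite !big_cons big_nil addr0.
  apply: le_trans (lerD (w2 _ (leqnn r)) (lerD (w2 _ (leqnSn r))
    (lerD (w2 _ rn) (w2 _ (leqW rn))))) _.
  by rewrite le_eqVlt; apply/orP; left; apply/eqP; ring.
under eq_bigr do rewrite mulr1.
rewrite -mulr_sumr.
apply: le_trans (_ : _ <= c * (26%:R * (weight R r)^-1)) _; last first.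
  by rewrite mulrA (mulrC c).
rewrite ler_wpM2l//; apply: le_trans (tail_sum_weightV4 R r n).
rewrite big_mkcond [leRHS]big_mkcond; apply: ler_sum => z _.
rewrite /p; case: ltnP => //= _; case: ifP => // _; exact: wV_ge0.
Qed.

(** The cut is made at the radius 1/t, where t is the largest of the |u_i - 1|;
    there both contributions are of order 1.  The constant 700 is rounded up from
    442 + 234. *)
Lemma cz_symbol_bound n :
  normc (\sum_(z <- box n) char3 u z * (a z)%:C%C) <= 700%:R * c.
Proof.
have [i0 _ i0P] := @Order.TotalTheory.arg_maxP _ _ 'I_3 ord0 xpredT (fun i => normc (u i - 1)) isT.
set t := normc (u i0 - 1) in i0P *.
have ut i : normc (u i - 1) <= t by exact: i0P.
have t0 : 0 <= t by exact: normc_ge0.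
have t2 : t <= 2.
  by apply: le_trans (ler_normcB _ _) _; rewrite u1 Normc.normc1; lra.
have [tn|tn] := leP (t * weight R n) 1.
  apply: le_trans (near n ut) _.
  have := ler_wpM2l (mulr_ge0 (ler0n _ 78) c0) tn; rewrite mulr1 => h.
  by apply: le_trans (lerD (lexx _) h) _; rewrite -mulrDl ler_wpM2r// -natrD ler_nat.
have tp : 0 < t.
  rewrite lt_def t0 andbT; apply/eqP => te; move: tn; rewrite te mul0r.
  by rewrite ltNge ler01.
(* here 1 / t < n + 1, so that the cut falls inside the box *)
set r := Num.truncn t^-1.
have /andP[rt tr] : r%:R <= t^-1 < r.+1%:R by apply: truncn_itv; rewrite invr_ge0.
have rn : (r <= n)%N.
  rewrite -ltnS -(ltr_nat R); apply: le_lt_trans rt _.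
  by rewrite -[ltLHS]mul1r ltr_pdivrMr// mulrC.
have -> : \sum_(z <- box n) char3 u z * (a z)%:C%C =
    \sum_(z <- box r) char3 u z * (a z)%:C%C +
    \sum_(z <- box n | (r < lat_norm z)%N) char3 u z * (a z)%:C%C.
  rewrite (bigID (fun z => (lat_norm z <= r)%N)) /= sum_box_le//; congr (_ + _).
  by apply: eq_bigl => z; rewrite ltnNge.
apply: le_trans (le_normcD _ _) _.
apply: le_trans (_ : _ <= 442%:R * c + 234%:R * c) _; last first.
  by rewrite -mulrDl ler_wpM2r// -natrD ler_nat.
apply: lerD.
  apply: le_trans (near r ut) _.
  have trw : t * weight R r <= 3%:R.
    rewrite /weight -natr1 mulrDr mulr1.
    have : t * r%:R <= 1 by rewrite mulrC -ler_pdivlMr// mul1r.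
    lra.
  have := ler_wpM2l (mulr_ge0 (ler0n _ 78) c0) trw => h.
  by apply: le_trans (lerD (lexx _) h) _; rewrite mulrAC -natrM -mulrDl -natrD.
have := far i0 rn; rewrite -/t mulrC -ler_pdivlMr// => /le_trans; apply.
have : (weight R r)^-1 / t <= 1.
  rewrite -invfM invf_le1 ?mulr_gt0 ?weight_gt0//.
  by rewrite mulrC -ler_pdivrMl// mulr1 ltW.
by move=> /(ler_wpM2l (mulr_ge0 (ler0n _ 234) c0)); rewrite mulr1 mulrA.
Qed.

End Symbol.

(** * Discrete Fourier transform and the bound on square-summable functions *)

Section DiscreteFourier.
Variable R : realType.
Local Notation normc := (@Normc.normc R).

Lemma primitive_root_exists n : (0 < n)%N -> {w : R[i] | n.-primitive_root w}.
Proof.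
move=> n_gt0; apply/sigW.
have [r Dp] := closed_field_poly_normal ('X^n - 1 : {poly R[i]}).
rewrite (monicP _) ?monicXnsubC// scale1r in Dp.
have rn1 : all n.-unity_root r by apply/allP => z; rewrite -root_prod_XsubC -Dp.
have sz_r : (n <= size r)%N.
  by rewrite -ltnS -(size_prod_XsubC r id) -Dp size_XnsubC.
have [|z] := hasP (has_prim_root n_gt0 rn1 _ sz_r); last by exists z.
by rewrite -separable_prod_XsubC -Dp separable_Xn_sub_1// pnatr_eq0 -lt0n.
Qed.

Variables (P : nat) (w : R[i]).
Hypothesis wP : P.-primitive_root w.

Let P0 : (0 < P)%N. Proof. exact: prim_order_gt0 wP. Qed.

Let w1 : normc w = 1.
Proof.
have := congr1 normc (prim_expr_order wP); rewrite normcX Normc.normc1 => /eqP.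
by rewrite pexpr_eq1 ?normc_ge0// => /eqP.
Qed.

Definition freq (k : {ffun 'I_3 -> 'I_P}) (i : 'I_3) : R[i] := w ^+ k i.

Lemma normc_freq k i : normc (freq k i) = 1.
Proof. by rewrite normcX w1 expr1n. Qed.

Let freq0 k i : freq k i != 0.
Proof. exact: normc_unit_neq0 (normc_freq k i). Qed.

Let w0 : w != 0. Proof. exact: normc_unit_neq0 w1. Qed.

(** The exponent is small enough for w^m to be 1 only if m = 0. *)
Lemma geometric_sum_root (m : int) : (`|m| < P)%N ->
  \sum_(j < P) (w ^ m) ^+ j = P%:R * (m == 0)%:R.
Proof.
move=> mP; have [->|m0] := eqVneq m 0.
  rewrite expr0z mulr1; under eq_bigr do rewrite expr1n.
  by rewrite sumr_const card_ord.
rewrite mulr0; have wm1 : w ^ m - 1 != 0.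
  rewrite subr_eq0; apply/negP => wm.
  have : w ^+ `|m|%N == 1.
    case: m wm mP {m0} => // m; rewrite NegzE -exprnN invr_eq1.
    by rewrite abszN.
  rewrite -(prim_order_dvd wP) => /dvdn_leq; rewrite lt0n absz_eq0 => /(_ m0).
  by rewrite leqNgt mP.
apply: (mulfI wm1); rewrite mulr0 -subrX1 exprnP exprzAC -exprnP.
by rewrite (prim_expr_order wP) exp1rz subrr.
Qed.

Lemma char3_orthogonality z : (lat_norm z < P)%N ->
  \sum_(k : {ffun 'I_3 -> 'I_P}) char3 (freq k) z = (P ^ 3)%:R * (z == 0)%:R.
Proof.
move=> zP.
rewrite /char3 /freq.
under eq_bigr do under eq_bigr do rewrite exprnP exprzAC -exprnP.
rewrite -(bigA_distr_bigA (fun i (j : 'I_P) => (w ^ z 0 i) ^+ j)) /=.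
under eq_bigr do rewrite geometric_sum_root ?(leq_ltn_trans (lat_norm_ge _ _))//.
have [->|z0] := eqVneq z 0.
  under eq_bigr do rewrite mxE eqxx mulr1.
  by rewrite prodr_const card_ord mulr1 natrX.
have /existsP[i zi] : [exists i, z 0 i != 0].
  rewrite -negb_forall; apply: contra z0 => /forallP z0.
  by apply/eqP/rowP => i; rewrite mxE; apply/eqP.
by rewrite (bigD1 i)//= (negbTE zi) mulr0 mul0r mulr0.
Qed.

Lemma char3N k z : char3 (freq k) (- z) = (char3 (freq k) z)^*%C.
Proof.
have cz0 : char3 (freq k) z != 0.
  by apply: normc_unit_neq0; apply: normc_char3 => i; exact: normc_freq.
apply: (mulfI cz0); rewrite -char3D// subrr -sqr_normc.
have -> : char3 (freq k) 0 = 1.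
  by rewrite /char3 big1// => i _; rewrite mxE expr0z.
have -> : `|char3 (freq k) z| = 1.
  rewrite (_ : `|_| = (normc (char3 (freq k) z))%:C%C)//.
  by rewrite normc_char3// => i; exact: normc_freq.
by rewrite expr1n.
Qed.

Definition fourier3 n (f : Z3 -> R) k : R[i] :=
  \sum_(x <- box n) (f x)%:C%C * char3 (freq k) x.

Lemma fourier3N n f k :
  \sum_(x <- box n) (f x)%:C%C * char3 (freq k) (- x) = (fourier3 n f k)^*%C.
Proof.
rewrite rmorph_sum; apply: eq_bigr => x _ /=; rewrite rmorphM char3N.
by congr (_ * _); apply/eqP; rewrite eq_complex /= oppr0 !eqxx.
Qed.

Lemma plancherel3 n f : (n.*2 < P)%N ->
  \sum_k normc (fourier3 n f k) ^+ 2 = (P ^ 3)%:R * \sum_(x <- box n) f x ^+ 2.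
Proof.
move=> nP; apply: (@complexI R).
rewrite rmorph_sum rmorphM rmorph_nat rmorph_sum /=.
transitivity (\sum_k \sum_(x <- box n) \sum_(y <- box n)
    (f x)%:C%C * (f y)%:C%C * char3 (freq k) (x - y)).
  apply: eq_bigr => k _.
  rewrite rmorphXn /= (_ : (normc _)%:C%C = `|fourier3 n f k|)// sqr_normc.
  rewrite -fourier3N /fourier3 mulr_suml; apply: eq_bigr => x _.
  rewrite mulr_sumr; apply: eq_bigr => y _.
  by rewrite char3D//; ring.
rewrite exchange_big mulr_sumr /= big_seq [RHS]big_seq; apply: eq_bigr => x xn.
rewrite exchange_big /=.
have E y : y \in box n -> \sum_k (f x)%:C%C * (f y)%:C%C * char3 (freq k) (x - y) =
    (f x)%:C%C * (f y)%:C%C * ((P ^ 3)%:R * (x == y)%:R).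
  move=> yn; rewrite -mulr_sumr char3_orthogonality ?subr_eq0//.
  move: xn yn; rewrite !mem_box => xn yn; apply: leq_ltn_trans nP.
  by apply: leq_trans (lat_normB _ _) _; rewrite -addnn leq_add.
rewrite (eq_big_seq _ E) (bigD1_seq x) ?box_uniq//= eqxx big1 ?addr0.
  by rewrite rmorphXn /=; ring.
by move=> y /negbTE yx; rewrite eq_sym yx !mulr0.
Qed.

(** The transform only sees points modulo P; since x - y - z has norm at most 4n,
    below P, it is 0 as soon as it is 0 modulo P, and there is no aliasing. *)
Lemma convolution3 n (a f g : Z3 -> R) : (n.*2.*2 < P)%N ->
  \sum_k fourier3 n.*2 a k * (fourier3 n f k)^*%C * fourier3 n g k =
  (P ^ 3)%:R * (\sum_(x <- box n) \sum_(y <- box n) f x * a (x - y) * g y)%:C%C.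
Proof.
move=> nP.
transitivity (\sum_k \sum_(x <- box n) \sum_(y <- box n) \sum_(z <- box n.*2)
    (f x)%:C%C * (a z)%:C%C * (g y)%:C%C * char3 (freq k) (z - x + y)).
  apply: eq_bigr => k _; rewrite -fourier3N /fourier3 -mulrA mulrC.
  rewrite -mulrA mulr_suml; apply: eq_bigr => x _.
  rewrite mulrA [X in X * _]mulr_sumr mulr_suml; apply: eq_bigr => y _.
  rewrite mulr_sumr; apply: eq_bigr => z _.
  by rewrite !char3D//; ring.
rewrite rmorph_sum mulr_sumr exchange_big /= big_seq [RHS]big_seq.
apply: eq_bigr => x xn; rewrite rmorph_sum mulr_sumr exchange_big /=.
rewrite big_seq [RHS]big_seq; apply: eq_bigr => y yn; rewrite exchange_big /=.
have E z : z \in box n.*2 ->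
    \sum_k (f x)%:C%C * (a z)%:C%C * (g y)%:C%C * char3 (freq k) (z - x + y) =
    (f x)%:C%C * (a z)%:C%C * (g y)%:C%C * ((P ^ 3)%:R * (z == x - y)%:R).
  move=> zn; rewrite -mulr_sumr char3_orthogonality.
    by rewrite addrAC -addrA -opprB subr_eq0.
  move: xn yn zn; rewrite !mem_box => xn yn zn; apply: leq_ltn_trans nP.
  rewrite -[n.*2.*2]addnn -{2}[n.*2]addnn addnA.
  apply: leq_trans (lat_normD _ _) _; rewrite leq_add//.
  by apply: leq_trans (lat_normB _ _) _; rewrite leq_add.
rewrite (eq_big_seq _ E) (bigD1_seq (x - y)) ?box_uniq//=; last first.
  move: xn yn; rewrite !mem_box => xn yn.
  by apply: leq_trans (lat_normB _ _) _; rewrite -addnn leq_add.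
rewrite eqxx big1 ?addr0; last by move=> z /negbTE ->; rewrite !mulr0.
by rewrite !rmorphM /=; ring.
Qed.

End DiscreteFourier.

(** Plancherel's identity with a bounded symbol; the product of the two transforms
    is split by the arithmetic-geometric mean inequality, which is why the bound is
    a sum of squares. *)
Lemma cz_bilinear_bound (R : realType) c (a : Z3 -> R) G n (f g : Z3 -> R) :
  cz_kernel c a G ->
  `|\sum_(x <- box n) \sum_(y <- box n) f x * a (x - y) * g y| <=
  350%:R * c * (\sum_(x <- box n) f x ^+ 2 + \sum_(x <- box n) g x ^+ 2).
Proof.
move=> aG; set S := \sum_(x <- box n) _.
have [w wP] := primitive_root_exists R (ltn0Sn n.*2.*2).
set P := n.*2.*2.+1 in wP.
have P0 : 0 < (P ^ 3)%:R :> R by rewrite ltr0n expn_gt0.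
have n2P : (n.*2 < P)%N by rewrite /P; lia.
rewrite -(ler_pM2l P0).
have -> : (P ^ 3)%:R * `|S| = Normc.normc ((P ^ 3)%:R * S%:C%C).
  by rewrite Normc.normcM normc_real -[(P ^ 3)%:R in RHS](rmorph_nat (real_complex R)) normc_real normr_nat.
rewrite -(convolution3 wP)//; apply: le_trans (ler_normc_sum _ _ _) _.
apply: le_trans (_ : _ <= \sum_(k : {ffun 'I_3 -> 'I_P}) 350%:R * c *
   (Normc.normc (fourier3 w n f k) ^+ 2 + Normc.normc (fourier3 w n g k) ^+ 2)) _;
  last first.
  rewrite -mulr_sumr big_split /= !(plancherel3 wP)// -mulrDr.
  by rewrite le_eqVlt; apply/orP; left; apply/eqP; ring.
apply: ler_sum => k _; rewrite !Normc.normcM.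
rewrite (_ : Normc.normc (fourier3 w n f k)^*%C = Normc.normc (fourier3 w n f k)); last first.
  by apply: (@complexI R); exact: normcJ.
have : Normc.normc (fourier3 w n.*2 a k) <= 700%:R * c.
  rewrite /fourier3; under eq_bigr do rewrite mulrC.
  exact: (cz_symbol_bound aG (normc_freq wP k)).
have : 0 <= Normc.normc (fourier3 w n.*2 a k) by exact: normc_ge0.
move: (Normc.normc _) (normc_ge0 (fourier3 w n f k)) (normc_ge0 (fourier3 w n g k)).
move: (Normc.normc _) (Normc.normc _) => A F K F0 K0 A0 Ac.
have c0 : 0 <= 700%:R * c by exact: le_trans Ac.
rewrite -mulrA; apply: le_trans (ler_wpM2r (mulr_ge0 F0 K0) Ac) _.
have -> : 350%:R * c = 700%:R * c / 2 by field.
rewrite -[leRHS]mulrA ler_wpM2l//.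
have := sqr_ge0 (F - K); rewrite sqrrB; lra.
Qed.

(** * Homogeneous functions smooth off the origin *)

Section VectorNorm.
Variable R : realType.
Implicit Types (x y : 'rV[R]_3).

Lemma normv_coord x i : `|x 0 i| <= `|x|.
Proof.
rewrite [leRHS]mx_normrE; exact: (le_bigmax _ (fun i : 'I_1 * 'I_3 => `|x i.1 i.2|) (0, i)).
Qed.

Lemma normv_le x r : 0 <= r -> (forall i, `|x 0 i| <= r) -> `|x| <= r.
Proof.
move=> r0 xr; rewrite [leLHS]mx_normrE; apply: bigmax_le => // -[i j] _ /=.
by rewrite ord1.
Qed.

Lemma normv_mulmx x (A : 'M[R]_3) :
  `|x *m A| <= `|x| * \sum_i \sum_j `|A i j|.
Proof.
have A0 i : 0 <= \sum_j `|A i j| by rewrite sumr_ge0.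
apply: normv_le => [|j]; first by rewrite mulr_ge0// sumr_ge0.
rewrite mxE; apply: le_trans (ler_norm_sum _ _ _) _.
rewrite mulr_sumr; apply: ler_sum => i _.
rewrite normrM ler_pM ?normv_coord//.
by rewrite (bigD1 j)//= lerDl sumr_ge0.
Qed.

End VectorNorm.

Section MeanValue.
Variable R : realType.
Implicit Types (f : 'rV[R]_3 -> R) (x z h : 'rV[R]_3) (i : 'I_3).

Let ev i : 'rV[R]_3 := delta_mx 0 i.

Lemma is_derive_line f x i (t : R) : derivable f (x + t *: ev i) (ev i) ->
  is_derive t 1 (fun s : R => f (x + s *: ev i)) (partial i f (x + t *: ev i)).
Proof.
move=> df.
have E : (fun h : R => h^-1 *: (((fun s : R => f (x + s *: ev i)) \o shift t) (h *: (1 : R)) -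
      f (x + t *: ev i))) =
    (fun h : R => h^-1 *: ((f \o shift (x + t *: ev i)) (h *: ev i) - f (x + t *: ev i))).
  apply/funext => h /=; congr (_ *: (f _ - _)).
  by rewrite scalerDl -[h *: 1]/(h * 1) mulr1 addrCA.
by split; rewrite /derivable /partial /derive E.
Qed.

Lemma mean_value_line f x i (t : R) :
  (forall s, `|s| <= `|t| -> derivable f (x + s *: ev i) (ev i)) ->
  exists2 s, `|s| <= `|t| & f (x + t *: ev i) - f x = t * partial i f (x + s *: ev i).
Proof.
move=> df; pose g s := f (x + s *: ev i).
have g0 : f x = g 0 by rewrite /g scale0r addr0.
have dg (s : R) : `|s| <= `|t| -> is_derive s (1 : R) g (partial i f (x + s *: ev i)).
  by move=> st; apply: is_derive_line; exact: df.
have cg (a b : R) : (forall s, s \in `[a, b]%R -> `|s| <= `|t|) ->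
    {within `[a, b], continuous g}.
  move=> ab; apply: derivable_within_continuous => s sab.
  by have [] := dg s (ab _ sab).
have [t0|t0] := leP 0 t.
  have st s : s \in `[0, t]%R -> `|s| <= `|t|.
    by rewrite in_itv /= => /andP[s0 st]; rewrite !ger0_norm.
  have [|s sab E] := @MVT_segment R g (fun s => partial i f (x + s *: ev i)) 0 t t0 _ (cg _ _ st).
    by move=> s sab; apply: dg; apply: st; exact: subset_itv_oo_cc.
  by exists s; [exact: st|rewrite g0 E subr0 mulrC].
have st s : s \in `[t, 0]%R -> `|s| <= `|t|.
  by rewrite in_itv /= => /andP[s0 st]; rewrite !ler0_norm ?lerN2// ltW.
have [|s sab E] := @MVT_segment R g (fun s => partial i f (x + s *: ev i)) t 0 (ltW t0) _ (cg _ _ st).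
  by move=> s sab; apply: dg; apply: st; exact: subset_itv_oo_cc.
exists s; first exact: st.
by rewrite g0 -[LHS]opprB E sub0r mulrN opprK mulrC.
Qed.

(** The increment is taken along a path of segments parallel to the axes, because
    only partial derivatives are at hand; in the sup norm this path stays in the
    ball of radius |h|. *)
Lemma mean_value_coord f z h :
  (forall x i, `|x - z| <= `|h| -> derivable f x (ev i)) ->
  exists2 x : 'I_3 -> 'rV[R]_3, forall i, `|x i - z| <= `|h| &
    f (z + h) - f z = \sum_i h 0 i * partial i f (x i).
Proof.
move=> df.
pose b k : 'rV[R]_3 := \row_j (z 0 j + if (j < k)%N then h 0 j else 0).
have b0 : b 0%N = z by apply/rowP => j; rewrite mxE ltn0 addr0.
have b3 : b 3%N = z + h by apply/rowP => j; rewrite !mxE ltn_ord.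
have bS (k : 'I_3) : b k.+1 = b k + h 0 k *: ev k.
  apply/rowP => j; rewrite !mxE eqxx /= ltnS leq_eqVlt.
  have [->|jk] := eqVneq j k; first by rewrite eqxx ltnn /= mulr1 addr0.
  have /negbTE -> : (j != k :> nat) by [].
  by rewrite /= mulr0 addr0.
have bh (k : 'I_3) s : `|s| <= `|h 0 k| -> `|b k + s *: ev k - z| <= `|h|.
  move=> sh; apply: normv_le => // j; rewrite !mxE eqxx /=.
  rewrite addrAC [z 0 j + _]addrC addrK.
  have [->|jk] := eqVneq j k.
    by rewrite ltnn add0r mulr1; exact: le_trans sh (normv_coord _ _).
  by rewrite mulr0 addr0; case: ifP => _; rewrite ?normr0// normv_coord.
have H (k : 'I_3) : exists s, `|s| <= `|h 0 k| /\
    f (b k.+1) - f (b k) = h 0 k * partial k f (b k + s *: ev k).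
  have [|s sh E] := @mean_value_line f (b k) k (h 0 k).
    by move=> s sh; apply: df; exact: bh.
  by exists s; rewrite bS.
have {}/choice[s sP] := H.
exists (fun k : 'I_3 => b k + s k *: ev k); first by move=> k; apply: bh; have [] := sP k.
rewrite -b3 -[in f z]b0 -(telescope_sumr (fun k => f (b k)))// big_mkord.
by apply: eq_bigr => k _; have [_ ->] := sP k.
Qed.

End MeanValue.

Section HomogeneousFunctions.
Variable R : realType.
Implicit Types (f g : 'rV[R]_3 -> R) (x z h : 'rV[R]_3) (i : 'I_3) (p : nat).

Definition smooth_homog p f :=
  smooth_on [set z | z != 0] f /\
  forall (t : R) z, 0 < t -> z != 0 -> f (t *: z) = t ^- p * f z.

Lemma smooth_on_partial U f i : smooth_on U f -> smooth_on U (partial i f).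
Proof.
move=> sf s x Ux; have -> : partials s (partial i f) = partials (rcons s i) f.
  by rewrite /partials foldr_rcons.
exact: sf.
Qed.

(** The difference quotient at tz with increment h is t^-(p+1) times the one at z
    with increment h/t. *)
Lemma partial_homog p f i : smooth_homog p f -> smooth_homog p.+1 (partial i f).
Proof.
move=> [sf hf]; split; first exact: smooth_on_partial.
move=> t z t0 z0.
have tz0 : t *: z != 0 by rewrite scaler_eq0 negb_or gt_eqF.
have [_ /(_ i) df] := sf [::] _ z0.
rewrite /partial /derive; set e := delta_mx 0 i.
apply: cvg_lim => //.
have : (fun h : R => t ^- p.+1 * ((h / t)^-1 *: ((f \o shift z) ((h / t) *: e) - f z)))
    @ 0^' --> t ^- p.+1 * 'D_e f z.
  apply: cvgMr; apply: (@cvg_comp _ _ _ (fun h : R => h / t)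
     (fun h : R => h^-1 *: ((f \o shift z) (h *: e) - f z)) (0^') (0^')); last exact: df.
  move=> A [e' e'0 HA]; exists (t * e'); rewrite /= ?mulr_gt0// => h /=.
  rewrite sub0r normrN => hte h0; apply: HA => /=; last by rewrite mulf_neq0// invr_neq0// gt_eqF.
  by rewrite sub0r normrN normrM normfV (gtr0_norm t0) ltr_pdivrMr// mulrC.
apply: cvg_trans; apply: near_eq_cvg.
have zn : 0 < `|z| by rewrite normr_gt0.
exists (t * `|z|); rewrite /= ?mulr_gt0// => h /=.
rewrite sub0r normrN => ht h0.
have E : h *: e + t *: z = t *: ((h / t) *: e + z).
  by rewrite scalerDr scalerA mulrCA divff ?mulr1// gt_eqF.
have nz : (h / t) *: e + z != 0.
  apply/eqP => /eqP; rewrite addr_eq0 => /eqP/(congr1 (fun x => `|x|)).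
  rewrite normrN normrZ normrM normfV (gtr0_norm t0) => H.
  have : `|e| <= 1.
    by apply: normv_le => // j; rewrite mxE eqxx /=; case: eqP; rewrite ?normr1 ?normr0.
  move=> /(ler_wpM2l (divr_ge0 (normr_ge0 h) (ltW t0))); rewrite H mulr1.
  by rewrite ler_pdivlMr// mulrC leNgt ht.
rewrite E !hf// -mulrBr.
rewrite -[RHS]/(h^-1 * _) -[in LHS]/((h / t)^-1 * _) exprS !mulrA; congr (_ * _).
have tn : t != 0 by rewrite gt_eqF.
have : t ^+ p != 0 by rewrite expf_neq0.
by move: (t ^+ p) => q q0; field; rewrite ?tn ?q0 ?h0.
Qed.

(** Compactness of the unit sphere. *)
Lemma homog_bound p f : smooth_homog p f ->
  exists2 c, 0 <= c & forall z, z != 0 -> `|f z| <= c * `|z| ^- p.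
Proof.
move=> [sf hf]; pose S := [set z : 'rV[R]_3 | `|z| = 1].
have cS : compact S.
  apply: bounded_closed_compact.
    by exists 1; split => // x x1 z /= ->; exact: ltW.
  have -> : S = (fun z : 'rV[R]_3 => `|z|) @^-1` [set 1] by [].
  by apply: closed_comp => [z _|]; [exact: norm_continuous|exact: closed_eq].
have : compact (f @` S).
  apply: continuous_compact => //; apply: continuous_in_subspaceT => z /[1!inE] z1.
  have z0 : z != 0 by rewrite -normr_gt0 z1.
  by have [] := sf [::] z z0.
move=> /compact_bounded[M [Mr HM]].
exists (`|M| + 1) => [|z z0]; first by rewrite addr_ge0.
have zn : 0 < `|z| by rewrite normr_gt0.
have {1}-> : z = `|z| *: (`|z|^-1 *: z).
  by rewrite scalerA divff ?scale1r// gt_eqF.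
rewrite hf//; last by rewrite scaler_eq0 negb_or invr_eq0 gt_eqF.
have znp : 0 <= `|z| ^- p by rewrite invr_ge0 exprn_ge0.
rewrite normrM (ger0_norm znp) [leRHS]mulrC ler_wpM2l//.
apply: HM; first by apply: le_lt_trans (ler_norm _) _; rewrite ltrDl.
exists (`|z|^-1 *: z) => //.
by rewrite /S /= normrZ normfV normr_id mulVf ?gt_eqF.
Qed.

Let near_half x z h : `|h| <= `|z| / 2 -> `|x - z| <= `|h| -> `|z| / 2 <= `|x|.
Proof.
move=> hz xh; have : `|z| <= `|x| + `|x - z|.
  by rewrite distrC -{1}(subrK x z) [z - x + x]addrC ler_normD.
lra.
Qed.

Let halfV p x z : z != 0 -> `|z| / 2 <= `|x| ->
  `|x| ^- p <= 2 ^+ p * `|z| ^- p.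
Proof.
move=> z0 zx; have zn : 0 < `|z| by rewrite normr_gt0.
have xn : 0 < `|x| by apply: lt_le_trans zx; rewrite divr_gt0.
rewrite -exprVn -[X in _ * X]exprVn -exprMn lerXn2r ?nnegrE ?mulr_ge0 ?invr_ge0//.
by rewrite -[X in X * _]invrK -invfM lef_pV2 ?posrE ?mulr_gt0 ?invr_gt0// mulrC.
Qed.

Let half_neq0 x z : z != 0 -> `|z| / 2 <= `|x| -> x != 0.
Proof.
move=> z0 zx; rewrite -normr_gt0; apply: lt_le_trans zx.
by rewrite divr_gt0// normr_gt0.
Qed.

(** For |h| <= |z|/2 the path from z to z + h stays at distance at least |z|/2 from
    the origin, where the derivatives are O(|z|^-(p+1)). *)
Lemma homog_increment p f : smooth_homog p f ->
  exists2 c, 0 <= c & forall z h, z != 0 -> `|h| <= `|z| / 2 ->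
    `|f (z + h) - f z| <= c * `|h| * `|z| ^- p.+1.
Proof.
move=> hf.
have /choice[c cP] : forall i, exists c, 0 <= c /\
    forall z, z != 0 -> `|partial i f z| <= c * `|z| ^- p.+1.
  by move=> i; have [c c0 cP] := homog_bound (partial_homog i hf); exists c.
exists (2 ^+ p.+1 * \sum_i c i) => [|z h z0 hz].
  by rewrite mulr_ge0 ?exprn_ge0// sumr_ge0// => i _; have [] := cP i.
have [|x xP ->] := @mean_value_coord R f z h.
  move=> x i xh; have x0 := half_neq0 z0 (near_half hz xh).
  by have [_] := hf.1 [::] x x0; exact.
apply: le_trans (ler_norm_sum _ _ _) _.
rewrite mulr_sumr !mulr_suml; apply: ler_sum => i _; rewrite normrM.
have zx := near_half hz (xP i).
have [ci0 ciP] := cP i.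
have {}ciP := ciP _ (half_neq0 z0 zx).
have -> : 2 ^+ p.+1 * c i * `|h| * `|z| ^- p.+1 = `|h| * (c i * (2 ^+ p.+1 * `|z| ^- p.+1)).
  by ring.
apply: ler_pM => //; first exact: normv_coord.
by apply: le_trans ciP _; rewrite ler_wpM2l// halfV.
Qed.

Lemma homog_taylor p f : smooth_homog p f ->
  exists2 c, 0 <= c & forall z h, z != 0 -> `|h| <= `|z| / 2 ->
    `|f (z + h) - f z - \sum_i h 0 i * partial i f z| <=
      c * `|h| ^+ 2 * `|z| ^- p.+2.
Proof.
move=> hf.
have /choice[c cP] : forall i, exists c, 0 <= c /\
    forall z h, z != 0 -> `|h| <= `|z| / 2 ->
      `|partial i f (z + h) - partial i f z| <= c * `|h| * `|z| ^- p.+2.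
  by move=> i; have [c c0 cP] := homog_increment (partial_homog i hf); exists c.
exists (\sum_i c i) => [|z h z0 hz].
  by rewrite sumr_ge0// => i _; have [] := cP i.
have [|x xP ->] := @mean_value_coord R f z h.
  move=> x i xh; have x0 := half_neq0 z0 (near_half hz xh).
  by have [_] := hf.1 [::] x x0; exact.
rewrite -sumrB; apply: le_trans (ler_norm_sum _ _ _) _.
rewrite !mulr_suml; apply: ler_sum => i _; rewrite -mulrBr normrM.
have [ci0 /(_ z (x i - z) z0 (le_trans (xP i) hz))] := cP i.
rewrite [z + _]addrC subrK => ciP.
have -> : c i * `|h| ^+ 2 * `|z| ^- p.+2 = `|h| * (c i * `|h| * `|z| ^- p.+2) by ring.
apply: ler_pM => //; first exact: normv_coord.
apply: le_trans ciP _; rewrite ler_wpM2r ?invr_ge0 ?exprn_ge0//.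
by rewrite ler_wpM2l.
Qed.

End HomogeneousFunctions.

(** * Restriction of a derivative of a homogeneous function to a lattice *)

Section LatticePoints.
Variables (R : realType) (v : 'I_3 -> 'rV[R]_3).

Definition lat_pt (z : Z3) : 'rV[R]_3 := \sum_(i < 3) (z 0 i)%:~R *: v i.

Lemma lat_pt0 : lat_pt 0 = 0.
Proof. by rewrite /lat_pt big1// => i _; rewrite mxE scale0r. Qed.

Lemma lat_ptD y z : lat_pt (y + z) = lat_pt y + lat_pt z.
Proof.
by rewrite -big_split; apply: eq_bigr => i _; rewrite mxE rmorphD scalerDl.
Qed.

Lemma lat_ptN z : lat_pt (- z) = - lat_pt z.
Proof.
by rewrite -sumrN; apply: eq_bigr => i _; rewrite mxE rmorphN scaleNr.
Qed.

Lemma lat_ptB y z : lat_pt (y - z) = lat_pt y - lat_pt z.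
Proof. by rewrite lat_ptD lat_ptN. Qed.

Lemma lat_pt_basis i : lat_pt (lat_basis i) = v i.
Proof.
rewrite /lat_pt (bigD1 i)//= mxE !eqxx scale1r big1 ?addr0// => j /negbTE ji.
by rewrite mxE ji andbF scale0r.
Qed.

Lemma lat_pt_mulmx z : lat_pt z = map_mx intr z *m (\matrix_i v i).
Proof.
rewrite mulmx_sum_row; apply: eq_bigr => i _; rewrite rowK mxE.
by congr (_ *: _).
Qed.

Hypothesis vfree : row_free (\matrix_i v i).

Let V := \matrix_i v i.
Let Vu : V \in unitmx. Proof. by rewrite -row_free_unit. Qed.

(** Coordinates in a basis are recovered by the inverse matrix; away from the
    origin 1 + |z| is at most 2|z|. *)
Lemma lat_pt_norm_ge :
  exists2 k, 0 < k & forall z, z != 0 -> k * weight R (lat_norm z) <= `|lat_pt z|.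
Proof.
pose s : R := \sum_i \sum_j `|invmx V i j| + 1.
have s0 : 0 < s by rewrite ltr_wpDl// sumr_ge0// => i _; rewrite sumr_ge0.
exists (2 * s)^-1 => [|z z0]; first by rewrite invr_gt0 mulr_gt0.
rewrite mulrC ler_pdivrMr ?mulr_gt0//.
have [i zi] : exists i, lat_norm z = `|z 0%R i|%N.
  have [|i zi] := @bigop.eq_bigmax _ (fun i : 'I_3 => `|z 0%R i|%N); first by rewrite card_ord.
  by exists i.
apply: le_trans (_ : _ <= 2 * (lat_norm z)%:R) _.
  by rewrite /weight -natrM ler_nat; move: z0; rewrite -lat_norm_eq0; lia.
rewrite mulrCA ler_wpM2l//.
have -> : (lat_norm z)%:R = `|(map_mx intr z : 'rV[R]_3) 0 i|.
  by rewrite mxE zi natr_absz intr_norm.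
have -> : map_mx intr z = lat_pt z *m invmx V.
  by rewrite lat_pt_mulmx mulmxK.
apply: le_trans (normv_coord _ _) _; apply: le_trans (normv_mulmx _ _) _.
by rewrite ler_wpM2l// lerDl.
Qed.

Lemma lat_pt_eq0 z : (lat_pt z == 0) = (z == 0).
Proof.
have [->|z0] := eqVneq z 0; first by rewrite lat_pt0 eqxx.
have [k k0 /(_ z z0) kz] := lat_pt_norm_ge.
apply/negbTE; rewrite -normr_gt0; apply: lt_le_trans kz.
by rewrite mulr_gt0// weight_gt0.
Qed.

Lemma lat_pt_inj : injective lat_pt.
Proof.
move=> y z yz; apply/eqP; rewrite -subr_eq0 -lat_pt_eq0 lat_ptB yz subrr.
exact: eqxx.
Qed.

(** The value 0 at the origin encodes the omission of the diagonal terms. *)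
Definition lat_kernel (F : 'rV[R]_3 -> R) (z : Z3) : R :=
  if z == 0 then 0 else F (lat_pt z).

Lemma lat_kernel_size p F : smooth_homog p F ->
  exists2 c, 0 <= c & forall z,
    `|lat_kernel F z| <= c * weight R (lat_norm z) ^- p.
Proof.
move=> /homog_bound[c c0 cP]; have [k k0 kP] := lat_pt_norm_ge.
exists (c * k ^- p) => [|z]; first by rewrite mulr_ge0 ?invr_ge0 ?exprn_ge0// ltW.
rewrite /lat_kernel; case: eqP => [_|/eqP z0].
  by rewrite normr0 !mulr_ge0 ?invr_ge0 ?exprn_ge0 ?weight_ge0// ltW.
have x0 : lat_pt z != 0 by rewrite lat_pt_eq0.
apply: le_trans (cP _ x0) _; rewrite -mulrA ler_wpM2l//.
have kw : 0 < k * weight R (lat_norm z) by rewrite mulr_gt0 ?weight_gt0.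
rewrite -invfM -exprMn lef_pV2 ?posrE ?exprn_gt0 ?normr_gt0//.
by rewrite lerXn2r ?nnegrE ?kP// ltW.
Qed.

(** Decay estimates are only needed at distance at least 2 nu from the origin, where
    Taylor expansions along the basis vectors are valid; the finitely many remaining
    points are absorbed in the constant. *)
Lemma lat_near_far (nu A : R) p (Q : Z3 -> R) : 0 <= nu -> 0 <= A ->
  (forall z, `|Q z| <= A) ->
  (exists2 c, 0 <= c & forall z, z != 0 -> nu <= `|lat_pt z| / 2 ->
     `|Q z| <= c * `|lat_pt z| ^- p) ->
  exists2 c, 0 <= c & forall z, `|Q z| <= c * weight R (lat_norm z) ^- p.
Proof.
move=> nu0 A0 QA [c c0 cP]; have [k k0 kP] := lat_pt_norm_ge.
pose N := 1 + 2 * nu / k.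
have N0 : 0 <= N by rewrite addr_ge0// divr_ge0 ?mulr_ge0// ltW.
have AN : 0 <= A * N ^+ p by rewrite mulr_ge0// exprn_ge0.
have ck : 0 <= c * k ^- p by rewrite mulr_ge0// invr_ge0 exprn_ge0// ltW.
exists (A * N ^+ p + c * k ^- p) => [|z]; first by rewrite addr_ge0.
have wV0 : 0 <= weight R (lat_norm z) ^- p by rewrite invr_ge0 exprn_ge0 ?weight_ge0.
have small : weight R (lat_norm z) <= N ->
    `|Q z| <= (A * N ^+ p + c * k ^- p) * weight R (lat_norm z) ^- p.
  move=> wN; rewrite mulrDl; apply: ler_wpDr.
    by rewrite mulr_ge0.
  apply: le_trans (QA z) _; rewrite -mulrA ler_peMr//.
  rewrite -expr_div_n exprn_ege1// ler_pdivlMr ?weight_gt0// mul1r//.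
have [z0|z0] := eqVneq z 0.
  apply: small; rewrite z0 lat_norm0 /weight /N lerDl divr_ge0 ?mulr_ge0//.
  exact: ltW.
have [far|/ltW near] := leP nu (`|lat_pt z| / 2); last first.
  apply: small; apply: (@le_trans _ _ (2 * nu / k)); last by rewrite lerDr.
  rewrite ler_pdivlMr// mulrC; apply: le_trans (kP _ z0) _.
  by move: near; rewrite ler_pdivrMr// mulrC.
rewrite mulrDl; apply: ler_wpDl; first by rewrite mulr_ge0.
apply: le_trans (cP _ z0 far) _; rewrite -mulrA ler_wpM2l//.
have kw : 0 < k * weight R (lat_norm z) by rewrite mulr_gt0 ?weight_gt0.
rewrite -invfM -exprMn lef_pV2 ?posrE ?exprn_gt0 ?normr_gt0 ?lat_pt_eq0//.
by rewrite lerXn2r ?nnegrE ?kP// ltW.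
Qed.

Let nu := \sum_i `|v i|.

Let vnu i : `|v i| <= nu.
Proof. by rewrite /nu (bigD1 i)//= lerDl sumr_ge0. Qed.

Let nu0 : 0 <= nu. Proof. by rewrite sumr_ge0. Qed.

Let far_neq0 z e : nu <= `|lat_pt z| / 2 -> z != 0 -> `|lat_pt e| <= nu ->
  z + e != 0.
Proof.
move=> zfar z0 enu; rewrite -lat_pt_eq0 lat_ptD; apply/eqP => /eqP.
rewrite addr_eq0 => /eqP ze; move: zfar; rewrite ze normrN.
have : 0 < `|lat_pt e| by rewrite -normrN -ze normr_gt0 lat_pt_eq0.
lra.
Qed.

Let weightV_le1 p r : weight R r ^- p <= 1.
Proof. by rewrite invf_le1 ?exprn_gt0 ?weight_gt0// exprn_ege1// weight_ge1. Qed.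

Lemma lat_kernel_smooth p F : smooth_homog p F ->
  exists2 c, 0 <= c & forall i z,
    `|lat_kernel F (z - lat_basis i) - lat_kernel F z| <=
       c * weight R (lat_norm z) ^- p.+1.
Proof.
move=> hF; have [A A0 AP] := lat_kernel_size hF.
have [c c0 cP] := homog_increment hF.
suff /choice[d dP] : forall i, exists d, 0 <= d /\ forall z,
    `|lat_kernel F (z - lat_basis i) - lat_kernel F z| <=
       d * weight R (lat_norm z) ^- p.+1.
  exists (\sum_i d i) => [|i z]; first by rewrite sumr_ge0// => i _; have [] := dP i.
  have [_ /(_ z)/le_trans] := dP i; apply.
  rewrite ler_wpM2r ?invr_ge0 ?exprn_ge0 ?weight_ge0//.
  by rewrite (bigD1 i)//= lerDl sumr_ge0// => j _; have [] := dP j.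
move=> i.
have A1 z : `|lat_kernel F z| <= A.
  by apply: le_trans (AP z) _; rewrite ler_piMr.
have [|||d d0 dP] := @lat_near_far nu (A + A) p.+1
    (fun z => lat_kernel F (z - lat_basis i) - lat_kernel F z) nu0.
- by rewrite addr_ge0.
- by move=> z; apply: le_trans (ler_normB _ _) _; rewrite lerD.
- exists (c * nu) => [|z z0 zfar]; first by rewrite mulr_ge0.
  have enu : `|lat_pt (- lat_basis i)| <= nu by rewrite lat_ptN normrN lat_pt_basis.
  rewrite /lat_kernel (negbTE (far_neq0 zfar z0 enu)) (negbTE z0) lat_ptD.
  apply: le_trans (cP _ _ _ (le_trans enu zfar)) _; first by rewrite lat_pt_eq0.
  by rewrite ler_wpM2r ?invr_ge0 ?exprn_ge0// ler_wpM2l.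
by exists d.
Qed.

Lemma lat_basis_decomp l :
  \sum_m invmx V l m *: v m = delta_mx 0 l.
Proof.
have := congr1 (row l) (mulVmx Vu); rewrite row1 => <-.
rewrite row_mul mulmx_sum_row; apply: eq_bigr => m _.
by rewrite rowK mxE.
Qed.

(** A first derivative is, up to a summable error, a lattice difference: expand
    the l-th unit vector in the lattice basis and replace each directional
    derivative by the corresponding increment. *)
Lemma partial_cz_kernel g l : smooth_homog 2 g ->
  exists c G, cz_kernel c (lat_kernel (partial l g)) G.
Proof.
move=> hg; pose W m := invmx V l m.
pose G m z := W m * lat_kernel g z.
have hF := partial_homog l hg.
have [c1 c10 sizeP] := lat_kernel_size hF.
have [c2 c20 smoothP] := lat_kernel_smooth hF.
have [c3 c30 potP] := lat_kernel_size hg.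
have [ct ct0 ctP] := homog_taylor hg.
pose s := \sum_m `|W m|.
have s0 : 0 <= s by rewrite sumr_ge0.
have Ws m : `|W m| <= s by rewrite /s (bigD1 m)//= lerDl sumr_ge0.
have G1 m z : `|G m z| <= s * c3.
  rewrite normrM ler_pM//; apply: le_trans (potP z) _; by rewrite ler_piMr.
have [|||c4 c40 cancelP] := @lat_near_far nu (c1 + \sum_(m < 3) (s * c3 + s * c3)) 4
    (fun z => lat_kernel (partial l g) z -
       \sum_(m < 3) (G m (z + lat_basis m) - G m z)) nu0.
- by rewrite addr_ge0// sumr_ge0// => m _; rewrite addr_ge0// mulr_ge0.
- move=> z; apply: le_trans (ler_normB _ _) _; apply: lerD.
    by apply: le_trans (sizeP z) _; rewrite ler_piMr.
  apply: le_trans (ler_norm_sum _ _ _) _; apply: ler_sum => m _.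
  by apply: le_trans (ler_normB _ _) _; rewrite lerD.
- exists (s * (ct * nu ^+ 2)) => [|z z0 zfar].
    by rewrite !mulr_ge0 ?exprn_ge0.
  have enu m : `|lat_pt (lat_basis m)| <= nu by rewrite lat_pt_basis.
  have x0 : lat_pt z != 0 by rewrite lat_pt_eq0.
  have -> : lat_kernel (partial l g) z =
      \sum_m W m * \sum_i v m 0 i * partial i g (lat_pt z).
    rewrite /lat_kernel (negbTE z0); under eq_bigr do rewrite mulr_sumr.
    rewrite exchange_big /= (bigD1 l)//= [X in _ + X]big1.
      rewrite addr0; under eq_bigr do rewrite mulrA.
      rewrite -mulr_suml -[LHS]mul1r; congr (_ * _).
      have /rowP/(_ l) := lat_basis_decomp l; rewrite summxE mxE !eqxx => H.
      by apply: etrans (esym H) _; apply: eq_bigr => m _; rewrite mxE.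
    move=> i il; under eq_bigr do rewrite mulrA.
    rewrite -mulr_suml (_ : \sum_m _ = 0) ?mul0r//.
    have /rowP/(_ i) := lat_basis_decomp l; rewrite summxE mxE (negbTE il) andbF => H.
    by apply: etrans H; apply: eq_bigr => m _; rewrite mxE.
  rewrite -sumrB; apply: le_trans (ler_norm_sum _ _ _) _.
  rewrite /s !mulr_suml; apply: ler_sum => m _.
  rewrite /G /lat_kernel (negbTE (far_neq0 zfar z0 (enu m))) (negbTE z0).
  rewrite -mulrBr -mulrBr normrM -mulrA ler_wpM2l// lat_ptD lat_pt_basis.
  rewrite distrC; apply: le_trans (ctP _ _ x0 (le_trans (vnu m) zfar)) _.
  rewrite ler_wpM2r ?invr_ge0 ?exprn_ge0// ler_wpM2l//.
  by rewrite lerXn2r ?nnegrE.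
pose c := c1 + c2 + s * c3 + c4.
have w0 p r : 0 <= weight R r ^- p by rewrite invr_ge0 exprn_ge0 ?weight_ge0.
have sc3 : 0 <= s * c3 by rewrite mulr_ge0.
exists c, G; split => [z|i z|i z|z].
- by apply: le_trans (sizeP z) _; rewrite ler_wpM2r// /c; lra.
- by apply: le_trans (smoothP i z) _; rewrite ler_wpM2r// /c; lra.
- rewrite normrM; apply: le_trans (ler_pM _ _ (Ws i) (potP z)) _ => //.
  by rewrite mulrA ler_wpM2r// /c; lra.
- by apply: le_trans (cancelP z) _; rewrite ler_wpM2r// /c; lra.
Qed.

End LatticePoints.

(** * Borel sets are Hausdorff measurable *)

Section EuclideanNorm.
Variable R : realType.
Implicit Types u : 'rV[R]_3.

(** The Hausdorff measure is built on the Euclidean norm whereas the topology is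
    that of the sup norm; this is the comparison needed between the two. *)
Lemma coord_le_enorm u i : `|u 0 i| <= enorm u.
Proof.
rewrite -sqrtr_sqr ler_wsqrtr// /dot (bigD1 i)//= expr2 lerDl.
by apply: sumr_ge0 => j _; rewrite -expr2 sqr_ge0.
Qed.

Lemma normv_le_enorm u : `|u| <= enorm u.
Proof. by apply: normv_le => [|i]; [exact: sqrtr_ge0|exact: coord_le_enorm]. Qed.

End EuclideanNorm.

Section HausdorffMetric.
Variables (R : realType) (k : nat).
Local Open Scope ereal_scope.
Implicit Types A B X U : set 'rV[R]_3.
Local Notation H := (@hausdorff R 3 k).

Lemma hausdorff_delta_ge0 d A : 0 <= hausdorff_delta k d A.
Proof.
apply: le_ereal_inf_tmp => _ [F _ <-]; apply: nneseries_ge0 => i _ _.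
exact: hausdorff_gauge_ge0.
Qed.

Lemma le_hausdorff_delta d d' A : (d' <= d)%R ->
  hausdorff_delta k d A <= hausdorff_delta k d' A.
Proof.
move=> dd; apply: le_ereal_inf_tmp => _ [F [Fd AF] <-].
apply: ereal_inf_lbound; exists F => //; split=> // i.
by apply: le_trans (Fd i) _; rewrite lee_fin.
Qed.

Lemma hausdorff_delta_le d A : (0 < d)%R -> hausdorff_delta k d A <= H A.
Proof. by move=> d0; apply: ereal_sup_ubound; exists d. Qed.

(** A set of diameter less than e cannot meet both A and B, so that a fine cover
    of the union splits into a cover of A and a cover of B. *)
Lemma hausdorff_delta_separated d (e : R) A B : (d < e)%R ->
  (forall x y, A x -> B y -> (e <= enorm (x - y))%R) ->
  hausdorff_delta k d A + hausdorff_delta k d B <= hausdorff_delta k d (A `|` B).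
Proof.
move=> de AB; apply: le_ereal_inf_tmp => _ [F [Fd ABF] <-].
pose G (Q : set 'rV[R]_3) i := if `[< F i `&` Q !=set0 >] then F i else set0.
have d0 : 0 <= d%:E by apply: le_trans (Fd 0%N); exact: diam_ge0.
have GQ Q : Q `<=` A `|` B ->
    hausdorff_delta k d Q <= \sum_(i <oo) hausdorff_gauge k (G Q i).
  move=> QAB; apply: ereal_inf_lbound; exists (G Q) => //; split => [i|x Qx].
    by rewrite /G; case: asboolP => [?|?] //; rewrite diam_set0.
  have [i _ Fix] := ABF _ (QAB _ Qx); exists i => //.
  by rewrite /G; case: asboolP => // -[]; exists x.
apply: le_trans (leeD (GQ A _) (GQ B _)) _.
- by move=> x Ax; left.
- by move=> x Bx; right.
rewrite -nneseriesD; [|by move=> i _ _; exact: hausdorff_gauge_ge0..].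
apply: lee_nneseries => [i _ _|i _].
  by rewrite adde_ge0// hausdorff_gauge_ge0.
have g0 : hausdorff_gauge k (set0 : set 'rV[R]_3) = 0.
  by rewrite /hausdorff_gauge eqxx.
rewrite /G; case: asboolP => [[x [Fx Ax]]|?]; last first.
  by rewrite g0 add0e; case: asboolP => [?|?] //; rewrite g0 hausdorff_gauge_ge0.
case: asboolP => [[y [Fy By]]|?]; last by rewrite g0 adde0.
have : (enorm (x - y))%:E <= d%:E.
  apply: le_trans (Fd i); apply: ereal_sup_ubound; right.
  by exists (x, y).
by rewrite lee_fin leNgt (lt_le_trans de)// AB.
Qed.

(** Additivity on separated sets: the defining property of a metric outer
    measure. *)
Lemma hausdorff_separated (e : R) A B : (0 < e)%R ->
  (forall x y, A x -> B y -> (e <= enorm (x - y))%R) ->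
  H A + H B <= H (A `|` B).
Proof.
move=> e0 AB; have [->|Hfin] := eqVneq (H (A `|` B)) +oo; first by rewrite leey.
have HABf : H (A `|` B) \is a fin_num.
  by rewrite ge0_fin_numE ?ltey// hausdorff_ge0.
have dd d1 d2 : (0 < d1)%R -> (0 < d2)%R ->
    hausdorff_delta k d1 A + hausdorff_delta k d2 B <= H (A `|` B).
  move=> d10 d20; pose d := Num.min (Num.min d1 d2) (e / 2)%R.
  have d0 : (0 < d)%R by rewrite !lt_min d10 d20 divr_gt0.
  apply: le_trans (hausdorff_delta_le _ d0).
  apply: le_trans (hausdorff_delta_separated (e := e) _ AB).
    by apply: leeD; apply: le_hausdorff_delta; rewrite !ge_min lexx ?orbT.
  by rewrite gt_min; apply/orP; right; rewrite ltr_pdivrMr// ltr_pMr// ltr1n.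
have Bf d : (0 < d)%R -> hausdorff_delta k d B \is a fin_num.
  move=> d0; rewrite ge0_fin_numE ?hausdorff_delta_ge0//.
  apply: le_lt_trans (_ : _ <= H (A `|` B)) _; last by rewrite ltey.
  apply: le_trans (dd _ _ d0 d0); rewrite leeDr// hausdorff_delta_ge0//.
have HA d : (0 < d)%R -> H A <= H (A `|` B) - hausdorff_delta k d B.
  move=> d0; apply: ge_ereal_sup => _ [d1 d10 <-].
  by rewrite leeBrDr ?Bf// dd.
have HAf : H A \is a fin_num.
  rewrite ge0_fin_numE ?hausdorff_ge0//.
  apply: le_lt_trans (HA _ ltr01) _; rewrite lteBlDr ?Bf//.
  by rewrite (lt_le_trans (_ : _ < +oo)) ?ltey// addye// gt_eqF// (lt_le_trans _ (hausdorff_delta_ge0 _ _)).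
rewrite addeC -leeBrDr//; apply: ge_ereal_sup => _ [d d0 <-].
by rewrite leeBrDr// addeC -leeBrDr ?Bf// HA.
Qed.

(** Caratheodory's criterion.  The points of U at distance at least 1/(m+1) from
    the complement are separated from the complement, and it has to be shown that
    they exhaust the measure of X in U.  The layers D m between consecutive such
    sets satisfy H (P m) + H (D (m+1)) <= H (P (m+2)), whence their tails sum up to at
    most 2 s - H (P m) - H (P (m+1)) with s the limit of H (P m). *)
Section OpenSets.
Variable U : set 'rV[R]_3.
Hypothesis oU : open U.

Let inner m : set 'rV[R]_3 :=
  [set x | forall y, ~ U y -> (m.+1%:R^-1 <= `|x - y|)%R].

Let inner_le m n : (m <= n)%N -> inner m `<=` inner n.
Proof.
move=> mn x xm y Uy; apply: le_trans (xm y Uy).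
by rewrite lef_pV2 ?posrE ?ltr0Sn// ler_nat ltnS.
Qed.

Let inner_cover x : U x -> exists m, inner m x.
Proof.
move=> Ux; have /nbhs_ballP[e /= e0 eU] : nbhs x U by exact: open_nbhs_nbhs.
have [m me] : exists m, (m.+1%:R^-1 < e)%R.
  exists (Num.truncn e^-1); rewrite invf_plt ?posrE ?ltr0Sn//.
  have ei : (0 <= e^-1)%R by rewrite invr_ge0 ltW.
  by have /andP[] := truncn_itv ei.
exists m => y Uy; rewrite leNgt; apply/negP => xy; apply: Uy; apply: eU.
by rewrite -ball_normE /=; exact: lt_trans xy me.
Qed.

Variable X : set 'rV[R]_3.
Let P m := X `&` inner m.
Let D m := P m.+1 `\` P m.

Let P_setD m : H (P m) + H (X `\` U) <= H X.
Proof.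
apply: (@le_trans _ _ (H (P m `|` (X `\` U)))); last first.
  by apply: le_hausdorff => x [[]|[]].
apply: (@hausdorff_separated m.+1%:R^-1); first by rewrite invr_gt0 ltr0Sn.
by move=> x y [_ xm] [_ Uy]; apply: le_trans (xm _ Uy) (normv_le_enorm _).
Qed.

Let P_D m : H (P m) + H (D m.+1) <= H (P m.+2).
Proof.
apply: (@le_trans _ _ (H (P m `|` D m.+1))); last first.
  by apply: le_hausdorff => x [[Xx xm]|[]//]; split => //; apply: (inner_le _ xm); lia.
apply: (@hausdorff_separated (m.+1%:R^-1 - m.+2%:R^-1)).
  by rewrite subr_gt0 ltf_pV2 ?posrE ?ltr0Sn// ltr_nat.
move=> x y [_ xm] [[Xy ym2] yNm].
apply: le_trans (normv_le_enorm _).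
have [w [Uw yw]] : exists w, ~ U w /\ (`|y - w| < m.+2%:R^-1)%R.
  apply: contrapT => /forallNP yw; apply: yNm; split => // w Uw.
  by rewrite leNgt; apply/negP => h; apply: (yw w).
have := xm _ Uw; have : (`|x - w| <= `|x - y| + `|y - w|)%R.
  by rewrite -[(x - w)%R](subrKA y) ler_normD.
by move: yw; move: (m.+1%:R^-1)%R (m.+2%:R^-1)%R => u1 u2; lra.
Qed.

Lemma open_caratheodory_le : H (X `&` U) + H (X `&` ~` U) <= H X.
Proof.
have [->|HX] := eqVneq (H X) +oo; first by rewrite leey.
have HXf : H X \is a fin_num by rewrite ge0_fin_numE ?ltey// hausdorff_ge0.
have sub_fin (Q : set 'rV[R]_3) : Q `<=` X -> H Q \is a fin_num.
  move=> QX; rewrite ge0_fin_numE ?hausdorff_ge0//.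
  by apply: (@le_lt_trans _ _ (H X)); [exact: le_hausdorff|rewrite ltey].
have PX m : P m `<=` X by move=> x [].
have DX m : D m `<=` X by move=> x [/PX].
pose p m := fine (H (P m)); pose q m := fine (H (D m)).
have pE m : H (P m) = (p m)%:E by rewrite fineK// sub_fin.
have qE m : H (D m) = (q m)%:E by rewrite fineK// sub_fin.
have pq m : (p m + q m.+1 <= p m.+2)%R.
  by have := P_D m; rewrite !pE qE.
have pmono m n : (m <= n)%N -> (p m <= p n)%R.
  move=> mn; rewrite -lee_fin -!pE; apply: le_hausdorff => x [Xx xm].
  by split => //; exact: (inner_le mn xm).
have XUf : H (X `&` U) \is a fin_num by apply: sub_fin => x [].
have XCf : H (X `&` ~` U) \is a fin_num by apply: sub_fin => x [].
pose a := fine (H (X `&` U)); pose b := fine (H (X `&` ~` U)); pose c := fine (H X).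
have aE : H (X `&` U) = a%:E by rewrite fineK.
have bE : H (X `&` ~` U) = b%:E by rewrite fineK.
have cE : H X = c%:E by rewrite fineK.
clearbody p q a b c.
have pbc m : (p m + b <= c)%R.
  by have := P_setD m; rewrite pE setDE bE cE.
have qsum m N : (\sum_(0 <= j < N) q (m.+1 + j)%N <=
    p (m.+1 + N)%N + p (m + N)%N - p m.+1 - p m)%R.
  elim: N => [|N IH]; first by rewrite big_nil !addn0; lra.
  rewrite big_nat_recr //=; apply: le_trans (lerD IH (lexx _)) _.
  have := pq (m + N)%N; rewrite !addnS !addSn; lra.
have [s [sp sle]] : exists s, (forall m, p m <= s)%R /\
    (forall e, 0 < e -> exists m, s - e < p m)%R.
  have hs : has_sup (range p).
    split; first by exists (p 0%N), 0%N.
    by exists (c - b)%R => _ [m _ <-]; rewrite lerBrDr.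
  exists (sup (range p)); split => [m|e e0].
    by apply: ub_le_sup; [exact: hs.2|exists m].
  by have [_ [m _ <-] h] := sup_adherent e0 hs; exists m.
have am m : (a <= 2 * s - p m)%R.
  have XU : X `&` U `<=` P m.+1 `|` \bigcup_j D (m.+1 + j)%N.
    move=> x [Xx Ux]; have [n xn] := inner_cover Ux.
    have [nm|mn] := leqP n m.+1; first by left; split => //; exact: (inner_le nm xn).
    have exn : exists n, `[< inner n x >] by exists n; apply/asboolP.
    case: (ex_minnP exn) => r /asboolP xr rmin.
    have [rm|mr] := leqP r m.+1; first by left; split => //; exact: (inner_le rm xr).
    right; exists (r.-1 - m.+1)%N => //; case: r xr rmin mr => // r xr rmin.
    rewrite ltnS => mr; rewrite /= subnKC//.
    by split=> // -[_ /asboolP/rmin]; rewrite ltnn.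
  have : H (X `&` U) <= H (P m.+1) + \sum_(j <oo) H (D (m.+1 + j)%N).
    apply: le_trans (le_hausdorff _ XU) _.
    apply: le_trans (outer_measureU2 H _ _) _.
    by rewrite leeD2l// outer_measure_sigma_subadditive.
  have : \sum_(j <oo) H (D (m.+1 + j)%N) <= (2 * s - p m.+1 - p m)%:E.
    apply: lime_le.
      by apply: is_cvg_nneseries => j _ _; exact: hausdorff_ge0.
    apply: nearW => N; under eq_bigr do rewrite qE.
    rewrite sumEFin lee_fin; apply: le_trans (qsum m N) _.
    have := sp (m.+1 + N)%N; have := sp (m + N)%N; lra.
  move=> h1 h2; have := le_trans h2 (leeD (lexx _) h1).
  rewrite pE aE -EFinD lee_fin; lra.
rewrite aE bE cE -EFinD lee_fin.
apply/ler_addgt0Pl => e e0; have [m] := sle _ (divr_gt0 e0 (ltr0Sn _ 1)).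
have := am m; have := pbc m; lra.
Qed.

End OpenSets.

Local Notation HT := (caratheodory_type H).

Lemma open_measurable_hausdorff U : open U -> measurable (U : set HT).
Proof.
move=> oU; apply: le_caratheodory_measurable => X.
exact: open_caratheodory_le.
Qed.

Lemma continuous_measurable_hausdorff (S U : set 'rV[R]_3) (f : 'rV[R]_3 -> R) :
  measurable (S : set HT) -> open U -> (forall x, U x -> {for x, continuous f}) ->
  measurable_fun (S `&` U : set HT) (f : HT -> R).
Proof.
move=> mS oU cf mSU.
apply: (measurability _ (measurable_realfun.RGenOInfty.measurableE R)) => //.
move=> /= _ [_ [a ->] <-].
rewrite -setIA; apply: measurableI => //; apply: open_measurable_hausdorff.
rewrite openE => x [Ux fx]; apply: filterI; first exact: open_nbhs_nbhs.
apply: (cf x Ux); apply: open_nbhs_nbhs; split => //.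
Qed.

End HausdorffMetric.

(** * Bounded measurable functions on sets of finite measure *)

Section BoundedMeasurable.
Variables (d : measure_display) (T : measurableType d) (R : realType).
Variable mu : {measure set T -> \bar R}.
Implicit Types (A N S : set T) (f g : T -> R).

Definition bounded_measurable A f :=
  measurable_fun A f /\ exists B, forall x, A x -> `|f x| <= B.

Lemma bounded_measurable_cst A r : bounded_measurable A (fun=> r).
Proof. by split; [exact: measurable_cst|exists `|r|]. Qed.

Lemma bounded_measurableD A f g : bounded_measurable A f ->
  bounded_measurable A g -> bounded_measurable A (fun x => f x + g x).
Proof.
move=> [mf [a fa]] [mg [b gb]]; split; first exact: measurable_funD.
exists (a + b) => x Ax; apply: le_trans (ler_normD _ _) _.
by rewrite lerD ?fa ?gb.
Qed.

Lemma bounded_measurableM A f g : bounded_measurable A f ->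
  bounded_measurable A g -> bounded_measurable A (fun x => f x * g x).
Proof.
move=> [mf [a fa]] [mg [b gb]]; split; first exact: measurable_funM.
by exists (a * b) => x Ax; rewrite normrM ler_pM ?fa ?gb.
Qed.

Lemma bounded_measurable_sum A (I : Type) (s : seq I) (f : I -> T -> R) :
  (forall i, bounded_measurable A (f i)) ->
  bounded_measurable A (fun x => \sum_(i <- s) f i x).
Proof.
move=> bf; elim: s => [|i s IH].
  by under eq_fun do rewrite big_nil; exact: bounded_measurable_cst.
by under eq_fun do rewrite big_cons; exact: bounded_measurableD.
Qed.

Lemma eq_bounded_measurable A f g : (forall x, A x -> f x = g x) ->
  bounded_measurable A f -> bounded_measurable A g.
Proof.
move=> fg [mf [B fB]]; split; last by exists B => x Ax; rewrite -fg// fB.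
by apply: eq_measurable_fun mf => x /[1!inE] /fg.
Qed.

Section FiniteMeasure.
Variable A : set T.
Hypotheses (mA : measurable A) (Afin : (mu A < +oo)%E).

Lemma bounded_measurable_integrable f : bounded_measurable A f ->
  mu.-integrable A (EFin \o f).
Proof.
move=> [mf [B fB]]; apply: measurable_bounded_integrable => //.
exists B; split => [|x Bx y Ay]; first exact: num_real.
by apply: le_trans (fB _ Ay) (ltW Bx).
Qed.

Lemma ler_norm_Rintegral f B : bounded_measurable A f ->
  (forall x, A x -> `|f x| <= B) ->
  `|\int[mu]_(x in A) f x| <= B * fine (mu A).
Proof.
move=> bf fB; have if_ := bounded_measurable_integrable bf.
apply: le_trans (le_normr_Rintegral mA if_) _.
rewrite -Rintegral_cst//; apply: le_Rintegral => //.
- apply: bounded_measurable_integrable; split; last by exists B => x Ax; rewrite normr_id fB.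
  by apply: measurableT_comp => //; exact: bf.1.
- exact: bounded_measurable_integrable (bounded_measurable_cst A B).
Qed.

Lemma Rintegral_finsum (I : Type) (s : seq I) (f : I -> T -> R) :
  (forall i, bounded_measurable A (f i)) ->
  \int[mu]_(x in A) (\sum_(i <- s) f i x) = \sum_(i <- s) \int[mu]_(x in A) f i x.
Proof.
move=> bf; elim: s => [|i s IH].
  rewrite big_nil; under eq_Rintegral do rewrite big_nil.
  by rewrite Rintegral_cst// mul0r.
rewrite big_cons -IH; under eq_Rintegral do rewrite big_cons.
rewrite RintegralD//; apply: bounded_measurable_integrable => //.
exact: bounded_measurable_sum.
Qed.

End FiniteMeasure.

(** By completeness f is measurable on all of S, whatever its values on N; this
    allows the singular values of the kernel on a null set to be ignored. *)
Lemma Rintegral_setD_null S N f : measure_is_complete mu ->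
  measurable S -> measurable N -> mu N = 0%E -> (mu S < +oo)%E ->
  bounded_measurable (S `\` N) f ->
  \int[mu]_(x in S) f x = \int[mu]_(x in S `\` N) f x.
Proof.
move=> mu_c mS mN N0 Sfin [mf _].
have mSN : measurable (S `\` N) by exact: measurableD.
have mfS : measurable_fun S f.
  move=> _ Y mY; rewrite (_ : S `&` _ =
      ((S `\` N) `&` f @^-1` Y) `|` (S `&` N `&` f @^-1` Y)).
    apply: measurableU; first exact: mf.
    by apply: mu_c; exists N; split => // x [[]].
  apply/seteqP; split => [x [Sx fx]|x [[[Sx _] fx]|[[Sx _] fx]]] //=.
  by have [Nx|Nx] := pselect (N x); [right|left].
rewrite [S `\` N]setDE Rintegral_mkcondr; congr fine.
have mg : measurable_fun S (f \_ (~` N)).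
  by apply/(measurable_restrict _ _ _).1; [exact: measurableC|exact: mS|rewrite -setDE].
apply: ae_eq_integral => //; [exact/measurable_EFinP|exact/measurable_EFinP|].
exists N; split => // x /= Hx; apply: contrapT => Nx; apply: Hx => Sx.
by rewrite patchE mem_set.
Qed.

End BoundedMeasurable.

(** * Averages of a kernel over two small surfaces *)

Section KernelAverages.
Variable R : realType.
Local Notation H2 := (@hausdorff R 3 2).
Local Notation HT := (caratheodory_type H2).
Local Notation mu := (@Haus R 3 2).
Implicit Types (x y z h : 'rV[R]_3) (F : 'rV[R]_3 -> R).

(** The modulus of continuity of a kernel that is C^1 off the origin and
    homogeneous of degree -3; it measures the error made in replacing an extended
    loop by a point. *)
Definition kernel_increment (c : R) F := forall z h, z != 0 ->
  `|h| <= `|z| / 2 -> `|F (z + h) - F z| <= c * `|h| * `|z| ^- 4.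

Lemma lipschitz_at_continuous (f : 'rV[R]_3 -> R) x (delta L : R) :
  0 < delta -> (forall h, `|h| <= delta -> `|f (x + h) - f x| <= L * `|h|) ->
  {for x, continuous f}.
Proof.
move=> delta0 fL; apply/(@cvgrPdist_le _ _ _ (nbhs x)) => e e0.
have L0 : 0 < `|L| + 1 by rewrite ltr_wpDl.
apply/nbhs_ballP; exists (Num.min delta (e / (`|L| + 1))) => /=.
  by rewrite lt_min delta0 divr_gt0.
move=> y; rewrite -ball_normE /= => xy.
have xye : `|y - x| < Num.min delta (e / (`|L| + 1)) by rewrite distrC.
move: xye; rewrite lt_min => /andP[yd ye].
have := fL (y - x) (ltW yd); rewrite [x + _]addrC subrK distrC => /le_trans; apply.
apply: (@le_trans _ _ ((`|L| + 1) * `|y - x|)).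
  by rewrite ler_wpM2r// ler_wpDr// ler_norm.
by rewrite mulrC -ler_pdivlMr// ltW.
Qed.

Variables (c : R) (F : 'rV[R]_3 -> R).
Hypotheses (c0 : 0 <= c) (Fc : kernel_increment c F).
Variables (x y z0 : 'rV[R]_3) (r : R) (S1 S2 : set 'rV[R]_3) (u w : 'rV[R]_3 -> R).
Hypotheses (xyz0 : x - y = z0) (r0 : 0 <= r) (z00 : z0 != 0) (rz0 : 8%:R * r <= `|z0|).
Hypotheses (mS1 : measurable (S1 : set HT)) (mS2 : measurable (S2 : set HT)).
Hypotheses (S1fin : (mu S1 < +oo)%E) (S2fin : (mu S2 < +oo)%E).
Hypotheses (S1r : forall x', S1 x' -> `|x' - x| <= r)
  (S2r : forall y', S2 y' -> `|y' - y| <= r).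
Hypotheses (mu_ : measurable_fun (S1 : set HT) (u : HT -> R))
  (mw : measurable_fun (S2 : set HT) (w : HT -> R)).
Hypotheses (u1 : forall x', S1 x' -> `|u x'| <= 1)
  (w1 : forall y', S2 y' -> `|w y'| <= 1).

Let d0 : 0 < `|z0|. Proof. by rewrite normr_gt0. Qed.
Let m1 := fine (mu S1).
Let m2 := fine (mu S2).
Let m10 : 0 <= m1. Proof. by rewrite fine_ge0. Qed.
Let m20 : 0 <= m2. Proof. by rewrite fine_ge0. Qed.
Let J x' := \int[mu]_(y' in S2) (F (x' - (y' : 'rV[R]_3)) * w y').

Let dist_z0 x' y' : `|(x' - y') - z0| <= `|x' - x| + `|y' - y|.
Proof.
have -> : (x' - y') - z0 = (x' - x) - (y' - y) by rewrite -xyz0 !opprD !opprK addrACA.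
exact: ler_normB.
Qed.

Let near_half x' y' : `|x' - x| <= `|z0| / 4%:R -> S2 y' -> `|z0| / 2 <= `|x' - y'|.
Proof.
move=> xx' /S2r yy'; have := dist_z0 x' y'.
have : `|z0| <= `|x' - y'| + `|(x' - y') - z0|.
  by rewrite [X in _ <= _ + X]distrC -{1}(subrK (x' - y') z0) addrC ler_normD.
move: d0 rz0; lra.
Qed.

Let bu : bounded_measurable (S1 : set HT) (u : HT -> R).
Proof. by split; [exact: mu_|exists 1]. Qed.

Let bw : bounded_measurable (S2 : set HT) (w : HT -> R).
Proof. by split; [exact: mw|exists 1]. Qed.

Let F_dist_z0 x' y' : `|x' - x| <= `|z0| / 4%:R -> S2 y' ->
  `|F (x' - y') - F z0| <= c * (`|x' - x| + `|y' - y|) * `|z0| ^- 4.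
Proof.
move=> xx' Sy'; have yy' := S2r Sy'.
have -> : x' - y' = z0 + ((x' - y') - z0) by rewrite [z0 + _]addrC subrK.
apply: le_trans (Fc _ _) _ => //.
  by apply: le_trans (dist_z0 _ _) _; move: d0 rz0; lra.
by rewrite ler_wpM2r ?invr_ge0 ?exprn_ge0// ler_wpM2l.
Qed.

(** For x' within |z0|/4 of x and y' in S2 the difference x' - y' stays within
    |z0|/2 of z0 = x - y, hence in the region where the increment estimate based at
    z0 applies. *)
Lemma kernel_section_bounded x' : `|x' - x| <= `|z0| / 4%:R ->
  bounded_measurable (S2 : set HT) (fun y' : HT => F (x' - (y' : 'rV[R]_3))).
Proof.
move=> xx'; split.
  pose U := [set y' : 'rV[R]_3 | y' != x'].
  have -> : S2 = S2 `&` U.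
    apply/seteqP; split => [y' Sy'|y' []//]; split => //=.
    apply/eqP => yx; have := near_half xx' Sy'; rewrite yx subrr normr0.
    by move: d0; lra.
  apply: continuous_measurable_hausdorff => // [|y' yx'].
    have -> : U = ~` [set x'] by apply/seteqP; split => z /eqP.
    by apply: closed_openC; exact: accessible_closed_set1 (hausdorff_accessible (@norm_hausdorff _ _)) _.
  have xy0 : x' - y' != 0 by rewrite subr_eq0 eq_sym.
  apply: (@lipschitz_at_continuous _ _ (`|x' - y'| / 2) (c * `|x' - y'| ^- 4)).
    by rewrite divr_gt0// normr_gt0.
  by move=> h hxy; rewrite opprD addrA mulrAC -(normrN h) Fc// normrN.
exists (`|F z0| + c * (`|x' - x| + r) * `|z0| ^- 4) => y' Sy'.
rewrite -[F _](subrK (F z0)) addrC; apply: le_trans (ler_normD _ _) _.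
rewrite lerD2l; apply: le_trans (F_dist_z0 xx' Sy') _.
by rewrite ler_wpM2r ?invr_ge0 ?exprn_ge0// ler_wpM2l// lerD2l S2r.
Qed.

Let bFw x' : `|x' - x| <= `|z0| / 4%:R ->
  bounded_measurable (S2 : set HT) (fun y' : HT => F (x' - (y' : 'rV[R]_3)) * w y').
Proof. by move=> xx'; apply: bounded_measurableM bw; exact: kernel_section_bounded. Qed.

Let J_lipschitz x' h : `|x' - x| <= `|z0| / 4%:R ->
  `|x' + h - x| <= `|z0| / 4%:R -> `|h| <= `|z0| / 4%:R ->
  `|J (x' + h) - J x'| <= c * (`|z0| / 2) ^- 4 * m2 * `|h|.
Proof.
move=> xx' xh' hz; rewrite /J -RintegralB//; [|exact: bounded_measurable_integrable (bFw _)..].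
have -> : c * (`|z0| / 2) ^- 4 * m2 * `|h| = c * `|h| * (`|z0| / 2) ^- 4 * m2 by ring.
apply: (@ler_norm_Rintegral _ HT R mu S2 mS2 S2fin (fun y' : HT =>
  F (x' + h - (y' : 'rV[R]_3)) * w y' - F (x' - (y' : 'rV[R]_3)) * w y')).
  have -> : (fun y' : HT => F (x' + h - (y' : 'rV[R]_3)) * w y' -
       F (x' - (y' : 'rV[R]_3)) * w y') =
     (fun y' : HT => F (x' + h - (y' : 'rV[R]_3)) * w y' +
       (- 1) * (F (x' - (y' : 'rV[R]_3)) * w y')).
    by apply/funext => y'; rewrite mulN1r.
  apply: bounded_measurableD; first exact: bFw.
  by apply: bounded_measurableM; [exact: bounded_measurable_cst|exact: bFw].
move=> y' Sy'; rewrite -mulrBl normrM -[leRHS]mulr1.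
apply: ler_pM => //; last exact: w1.
have zxy := near_half xx' Sy'.
have xy0 : x' - y' != 0.
  by rewrite -normr_gt0; apply: lt_le_trans zxy; rewrite divr_gt0.
rewrite addrAC; apply: le_trans (Fc xy0 _) _; first by lra.
rewrite ler_wpM2l ?mulr_ge0// lef_pV2 ?posrE ?exprn_gt0 ?divr_gt0 ?normr_gt0//.
by rewrite lerXn2r ?nnegrE ?divr_ge0.
Qed.

(** The inner integral depends on x' in a Lipschitz way near x, which gives its
    measurability without recourse to product measures. *)
Lemma kernel_average_bounded : bounded_measurable (S1 : set HT) (J : HT -> R).
Proof.
have S1q x' : S1 x' -> `|x' - x| <= `|z0| / 4%:R.
  by move=> /S1r; move: rz0 r0; lra.
split.
  pose U := [set x' : 'rV[R]_3 | `|x - x'| < `|z0| / 4%:R].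
  have -> : S1 = S1 `&` U.
    apply/seteqP; split => [x' Sx'|x' []//]; split => //=.
    by rewrite /U /= distrC; have := S1r Sx'; move: rz0 r0 d0; lra.
  apply: continuous_measurable_hausdorff => // [|x' xx'].
    by have -> : U = ball x (`|z0| / 4%:R); [rewrite -ball_normE|exact: ball_open].
  rewrite /U /= distrC in xx'.
  apply: (@lipschitz_at_continuous _ _ (`|z0| / 4%:R - `|x' - x|)
      (c * (`|z0| / 2) ^- 4 * m2)); first by rewrite subr_gt0.
  move=> h hz; apply: J_lipschitz; first exact: ltW.
    rewrite addrAC; apply: le_trans (ler_normD _ _) _; lra.
  by have := normr_ge0 (x' - x); lra.
exists ((`|F z0| + c * (`|z0| / 4%:R + r) * `|z0| ^- 4) * m2) => x' Sx'.
apply: (@ler_norm_Rintegral _ HT R mu S2 mS2 S2fin (fun y' : HT =>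
  F (x' - (y' : 'rV[R]_3)) * w y') _ (bFw (S1q _ Sx'))).
move=> y' Sy'; rewrite normrM -[leRHS]mulr1; apply: ler_pM => //; last exact: w1.
rewrite -[F _](subrK (F z0)) addrC; apply: le_trans (ler_normD _ _) _.
rewrite lerD2l; apply: le_trans (F_dist_z0 (S1q _ Sx') Sy') _.
by rewrite ler_wpM2r ?invr_ge0 ?exprn_ge0// ler_wpM2l// lerD ?S1q ?S2r.
Qed.

Lemma kernel_double_average :
  `|\int[mu]_(x' in S1) (u x' * J x') -
    F z0 * (\int[mu]_(x' in S1) u x') * (\int[mu]_(y' in S2) w y')| <=
  c * (2 * r) * `|z0| ^- 4 * m1 * m2.
Proof.
set W := \int[mu]_(y' in S2) w y'.
have bJ := kernel_average_bounded.
have bFW : bounded_measurable (S1 : set HT) (fun x' : HT => (F z0 * W) * u x').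
  by apply: bounded_measurableM => //; exact: bounded_measurable_cst.
have buJ : bounded_measurable (S1 : set HT) (fun x' : HT => u x' * J x').
  exact: bounded_measurableM.
have -> : F z0 * (\int[mu]_(x' in S1) u x') * W =
    \int[mu]_(x' in S1) ((F z0 * W) * u x').
  by rewrite RintegralZl//; [ring|exact: bounded_measurable_integrable].
rewrite -RintegralB//; [|exact: bounded_measurable_integrable..].
rewrite mulrAC; apply: (@ler_norm_Rintegral _ HT R mu S1 mS1 S1fin
  (fun x' : HT => u x' * J x' - F z0 * W * u x')).
  apply: eq_bounded_measurable (bounded_measurableD buJ
      (bounded_measurableM (bounded_measurable_cst (S1 : set HT) (-1)) bFW)).
  by move=> x' _; rewrite mulN1r.
move=> x' Sx'; have xx' : `|x' - x| <= `|z0| / 4%:R.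
  by have := S1r Sx'; move: rz0 r0; lra.
have -> : u x' * J x' - F z0 * W * u x' = u x' * (J x' - F z0 * W) by ring.
rewrite normrM -[leRHS]mul1r; apply: ler_pM => //; first exact: u1.
have bzw : bounded_measurable (S2 : set HT) (fun y' : HT => F z0 * w y').
  by apply: bounded_measurableM => //; exact: bounded_measurable_cst.
rewrite /W -RintegralZl//; last exact: bounded_measurable_integrable.
rewrite /J -RintegralB//; [|exact: bounded_measurable_integrable (bFw xx')
  |exact: bounded_measurable_integrable].
apply: (@ler_norm_Rintegral _ HT R mu S2 mS2 S2fin (fun y' : HT =>
  F (x' - (y' : 'rV[R]_3)) * w y' - F z0 * w y')).
  apply: eq_bounded_measurable (bounded_measurableD (bFw xx')
      (bounded_measurableM (bounded_measurable_cst (S2 : set HT) (-1)) bzw)).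
  by move=> y' _; rewrite mulN1r.
move=> y' Sy'; rewrite -mulrBl normrM -[leRHS]mulr1.
apply: ler_pM => //; last exact: w1.
apply: le_trans (F_dist_z0 xx' Sy') _.
rewrite ler_wpM2r ?invr_ge0 ?exprn_ge0// ler_wpM2l//.
by have := S1r Sx'; have := S2r Sy'; lra.
Qed.

End KernelAverages.

(** * The interaction of two loops *)

Section ElasticKernel.
Variables (R : realType) (C : tensor4 R) (K : 'rV[R]_3 -> 'M[R]_3).
Hypothesis CK : green_function C K.

Lemma green_function_homog k j : smooth_homog 1 (fun z => K z k j).
Proof.
have [sK hK _] := CK; split; first exact: sK.
by move=> t z t0 z0; rewrite hK// mxE expr1.
Qed.

(** Each of the two derivatives lowers the degree of homogeneity by one, from -1
    down to -3. *)
Lemma elastic_kernel_increment : exists2 c, 0 <= c &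
  forall i j i' j', kernel_increment c (fun z => elastic_kernel C K z i j i' j').
Proof.
pose I4 := ('I_3 * 'I_3 * ('I_3 * 'I_3))%type.
have /choice[c cP] : forall q : I4, exists c, 0 <= c /\
    kernel_increment c (partials [:: q.1.2; q.2.2] (fun z => K z q.1.1 q.2.1)).
  move=> [[k l] [k' l']].
  have [c c0 cP] := homog_increment (partial_homog l (partial_homog l' (green_function_homog k k'))).
  by exists c.
pose s : R := \sum_(p : I4) `|C p.1.1 p.1.2 p.2.1 p.2.2|.
have Cs i j k l : `|C i j k l| <= s.
  by rewrite /s (bigD1 (i, j, (k, l)))//= lerDl sumr_ge0.
have s0 : 0 <= s by rewrite sumr_ge0.
clearbody s; exists (\sum_(q : I4) s * s * c q) => [|i j i' j' z h z0 hz].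
  by apply: sumr_ge0 => q _; rewrite !mulr_ge0//; have [] := cP q.
have kE w : elastic_kernel C K w i j i' j' = \sum_(q : I4)
    C i j q.1.1 q.1.2 * partials [:: q.1.2; q.2.2] (fun z => K z q.1.1 q.2.1) w *
    C q.2.1 q.2.2 i' j'.
  rewrite /elastic_kernel pair_bigA /=; under eq_bigr do rewrite pair_bigA /=.
  by rewrite pair_bigA.
rewrite !kE -sumrB; apply: le_trans (ler_norm_sum _ _ _) _.
rewrite !mulr_suml; apply: ler_sum => q _; rewrite -mulrBl -mulrBr !normrM.
have [cq0 /(_ z h z0 hz) cqP] := cP q.
have -> : s * s * c q * `|h| * `|z| ^- 4 = s * (c q * `|h| * `|z| ^- 4) * s by ring.
by apply: ler_pM => //; rewrite ?mulr_ge0//; apply: ler_pM.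
Qed.

End ElasticKernel.

Section Interaction.
Variable R : realType.
Local Notation H2 := (@hausdorff R 3 2).
Local Notation HT := (caratheodory_type H2).
Local Notation mu := (@Haus R 3 2).
Local Notation I4 := ('I_3 * 'I_3 * ('I_3 * 'I_3))%type.
Implicit Types (x y z : 'rV[R]_3) (L : dislocation_loop R).

Lemma frob_tapp (A B : 'M[R]_3) (T : tensor4 R) :
  frob A (tapp T B) = \sum_(q : I4)
    A q.1.1 q.1.2 * (T q.1.1 q.1.2 q.2.1 q.2.2 * B q.2.1 q.2.2).
Proof.
rewrite /frob pair_bigA /=.
under eq_bigr do rewrite mxE pair_bigA /= mulr_sumr.
by rewrite pair_bigA.
Qed.

Lemma otimesE (b n : 'rV[R]_3) i j : otimes b n i j = b 0 i * n 0 j.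
Proof. by rewrite /otimes mxE big_ord1 mxE. Qed.

(** The integral of the length of the Burgers vector over the slip surface. *)
Definition slip_mass L : R := enorm (burgers L) * fine (mu (slip_surface L)).

Lemma slip_mass_ge0 L : 0 <= slip_mass L.
Proof. by rewrite mulr_ge0 ?sqrtr_ge0// fine_ge0. Qed.

(** What the estimates below use of a loop: off a null set N the normal has
    components at most 1 and, for a localized loop, the slip surface lies within
    distance r of x. *)
Definition regular_off L (N : set 'rV[R]_3) :=
  [/\ measurable (slip_surface L : set HT), (mu (slip_surface L) < +oo)%E,
      measurable (N : set HT) /\ mu N = 0%E,
      forall i, measurable_fun (slip_surface L : set HT)
                  (fun y : HT => slip_normal L y 0 i)
    & forall y i, slip_surface L y -> ~ N y -> `|slip_normal L y 0 i| <= 1].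

Definition localized L x (r : R) (N : set 'rV[R]_3) :=
  regular_off L N /\ forall y, slip_surface L y -> ~ N y -> `|y - x| <= r.

Lemma loop_regular L : is_dislocation_loop L -> exists N, regular_off L N.
Proof.
move=> [_ [[mS Sfin _] [mn nP]] _]; have [N [mN N0 NP]] := nP.
exists N; split => // y i Sy Ny.
have [n1 _] : enorm (slip_normal L y) = 1 /\
    approx_tangent 2 (slip_surface L) y [set z | dot (slip_normal L y) z = 0].
  by apply: contrapT => H; apply: Ny; apply: NP => /(_ Sy).
by rewrite -n1 coord_le_enorm.
Qed.

Lemma loop_localized L x r : is_dislocation_loop L ->
  (ess_sup mu (fun y => (enorm (x - (y : 'rV[R]_3)) *
                           \1_(slip_surface L) y)%:E) <= r%:E)%E ->
  exists N, localized L x r N.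
Proof.
move=> /loop_regular[N [mS Sfin [mN N0] mn nP]] /ess_supP [N' [mN' N'0 NP']].
exists (N `|` N'); split.
  split => //; first by split; [exact: measurableU|rewrite measureU0].
  by move=> y i Sy Ny; apply: nP => // yN; apply: Ny; left.
move=> y Sy Ny.
have yr : ((enorm (x - y) * \1_(slip_surface L) y)%:E <= r%:E)%E.
  by apply: contrapT => H; apply: Ny; right; apply: NP'.
move: yr; rewrite indicE mem_set// mulr1 lee_fin; apply: le_trans.
by rewrite distrC normv_le_enorm.
Qed.

Lemma slip_normal_bounded L N i : regular_off L N ->
  bounded_measurable (slip_surface L `\` N : set HT)
    (fun y : HT => slip_normal L y 0 i).
Proof.
move=> [mS _ [mN _] mn nP]; split; last by exists 1 => y [Sy Ny]; exact: nP.
by apply: measurable_funS (mn i) => //; exact: subDsetl.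
Qed.

Lemma oriented_areaE L N i j : regular_off L N ->
  oriented_area L i j = burgers L 0 i *
    \int[mu]_(y in slip_surface L `\` N) slip_normal L y 0 j.
Proof.
move=> LN; have [mS Sfin [mN N0] _ _] := LN.
have bn := slip_normal_bounded j LN.
have mSN : measurable (slip_surface L `\` N : set HT) by exact: measurableD.
have SNfin : (mu (slip_surface L `\` N) < +oo)%E.
  by apply: le_lt_trans Sfin; apply: le_measure; rewrite ?inE//; exact: subDsetl.
rewrite mxE; under eq_Rintegral do rewrite otimesE.
apply: etrans (@Rintegral_setD_null _ HT R mu (slip_surface L) N
  (fun y : HT => burgers L 0 i * slip_normal L y 0 j) _ mS mN N0 Sfin _) _.
- exact: measure_is_complete_caratheodory.
- by apply: bounded_measurableM bn; exact: bounded_measurable_cst.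
- by rewrite RintegralZl//; exact: bounded_measurable_integrable.
Qed.

Lemma oriented_area_le L N i j : regular_off L N ->
  `|oriented_area L i j| <= slip_mass L.
Proof.
move=> LN; have [mS Sfin [mN N0] _ nP] := LN.
have bn := slip_normal_bounded j LN.
have mSN : measurable (slip_surface L `\` N : set HT) by exact: measurableD.
have SNle : (mu (slip_surface L `\` N) <= mu (slip_surface L))%E.
  by apply: le_measure; rewrite ?inE//; exact: subDsetl.
rewrite (oriented_areaE _ _ LN) normrM ler_pM// ?coord_le_enorm//.
apply: le_trans (ler_norm_Rintegral (B := 1) mSN _ bn _) _.
- exact: le_lt_trans SNle Sfin.
- by move=> y [Sy Ny]; exact: nP.
rewrite mul1r fine_le// ge0_fin_numE//; exact: le_lt_trans SNle Sfin.
Qed.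

(** The energy of a pair is a sum of 81 double averages of kernel components; the
    hypothesis 8 r <= |x - y| keeps the two surfaces well apart. *)
Lemma interaction_near_point (M : 'rV[R]_3 -> tensor4 R) (c r : R) L1 L2 x y N1 N2 :
  0 <= c -> 0 <= r ->
  (forall i j k l, kernel_increment c (fun z => M z i j k l)) ->
  x - y != 0 -> 8%:R * r <= `|x - y| ->
  localized L1 x r N1 -> localized L2 y r N2 ->
  `|interaction M L1 L2 -
    frob (oriented_area L1) (tapp (M (x - y)) (oriented_area L2))| <=
  81%:R * (c * (2 * r) * `|x - y| ^- 4) * slip_mass L1 * slip_mass L2.
Proof.
move=> c0 r0 Mc xy0 rxy LN1 LN2.
have [LN1' r1P] := LN1; have [LN2' r2P] := LN2.
have [mS1 S1fin [mN1 N10] mn1 n1P] := LN1'.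
have [mS2 S2fin [mN2 N20] mn2 n2P] := LN2'.
set S1 := slip_surface L1 `\` N1; set S2 := slip_surface L2 `\` N2.
have mS1' : measurable (S1 : set HT) by exact: measurableD.
have mS2' : measurable (S2 : set HT) by exact: measurableD.
have S1le : (mu S1 <= mu (slip_surface L1))%E.
  by apply: le_measure; rewrite ?inE//; exact: subDsetl.
have S2le : (mu S2 <= mu (slip_surface L2))%E.
  by apply: le_measure; rewrite ?inE//; exact: subDsetl.
have S1fin' : (mu S1 < +oo)%E by exact: le_lt_trans S1le S1fin.
have S2fin' : (mu S2 < +oo)%E by exact: le_lt_trans S2le S2fin.
have S1r x' : S1 x' -> `|x' - x| <= r by move=> [Sx Nx]; exact: r1P.
have S2r y' : S2 y' -> `|y' - y| <= r by move=> [Sy Ny]; exact: r2P.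
have n11 j x' : S1 x' -> `|slip_normal L1 x' 0 j| <= 1.
  by move=> [Sx Nx]; exact: n1P.
have n21 j y' : S2 y' -> `|slip_normal L2 y' 0 j| <= 1.
  by move=> [Sy Ny]; exact: n2P.
have bn1 j := slip_normal_bounded j LN1'.
have bn2 j := slip_normal_bounded j LN2'.
have xq x' : S1 x' -> `|x' - x| <= `|x - y| / 4%:R by move=> /S1r; lra.
pose b1 := burgers L1; pose b2 := burgers L2.
pose F (q : I4) z := M z q.1.1 q.1.2 q.2.1 q.2.2.
have Fc q : kernel_increment c (F q) by exact: Mc.
pose n1 (q : I4) x' := slip_normal L1 x' 0 q.1.2.
pose n2 (q : I4) y' := slip_normal L2 y' 0 q.2.2.
pose J q x' := \int[mu]_(y' in S2) (F q (x' - (y' : 'rV[R]_3)) * n2 q y').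
have bFn q x' : S1 x' -> bounded_measurable (S2 : set HT)
    (fun y' : HT => F q (x' - (y' : 'rV[R]_3)) * n2 q y').
  move=> Sx'; apply: bounded_measurableM; last exact: bn2.
  exact: (kernel_section_bounded c0 (Fc q) erefl xy0 rxy mS2' S2r (xq _ Sx')).
have bJ q : bounded_measurable (S1 : set HT) (J q : HT -> R).
  exact: (kernel_average_bounded c0 (Fc q) erefl r0 xy0 rxy mS1' mS2' S2fin' S1r S2r
    (bn2 _).1 (n21 _)).
pose G (q : I4) x' := b1 0 q.1.1 * b2 0 q.2.1 * (n1 q x' * J q x').
have bG q : bounded_measurable (S1 : set HT) (G q : HT -> R).
  apply: bounded_measurableM; first exact: bounded_measurable_cst.
  by apply: bounded_measurableM; [exact: bn1|exact: bJ].
have inner x' : S1 x' -> \int[mu]_(y' in slip_surface L2)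
    frob (otimes (burgers L1) (slip_normal L1 x'))
      (tapp (M ((x' : 'rV[R]_3) - (y' : 'rV[R]_3)))
            (otimes (burgers L2) (slip_normal L2 y'))) = \sum_q G q x'.
  move=> Sx'; pose g (q : I4) (y' : HT) := b1 0 q.1.1 * b2 0 q.2.1 * n1 q x' *
    (F q (x' - (y' : 'rV[R]_3)) * n2 q y').
  have bg q : bounded_measurable (S2 : set HT) (g q).
    by apply: bounded_measurableM; [exact: bounded_measurable_cst|exact: bFn].
  under eq_Rintegral => y' _.
    rewrite frob_tapp.
    under eq_bigr => q _.
      rewrite !otimesE (_ : _ * _ = g q y').
      over.
      by rewrite /g /b1 /b2 /n1 /n2 /F; ring.
    over.
  apply: etrans (@Rintegral_setD_null _ HT R mu (slip_surface L2) N2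
    (fun y' : HT => \sum_q g q y') _ mS2 mN2 N20 S2fin _) _.
  - exact: measure_is_complete_caratheodory.
  - exact: bounded_measurable_sum.
  rewrite Rintegral_finsum//; apply: eq_bigr => q _.
  rewrite /g RintegralZl//; first by rewrite /G mulrA.
  exact: (bounded_measurable_integrable mS2' S2fin' (bFn q x' Sx')).
have -> : interaction M L1 L2 = \sum_(q : I4) \int[mu]_(x' in S1) G q x'.
  rewrite /interaction; set f := fun x' : HT => Rintegral mu (slip_surface L2) _.
  have fG x' : S1 x' -> \sum_q G q x' = f x' by move=> Sx'; rewrite -inner.
  apply: etrans (@Rintegral_setD_null _ HT R mu (slip_surface L1) N1 f _ mS1 mN1
    N10 S1fin _) _.
  - exact: measure_is_complete_caratheodory.
  - apply: (@eq_bounded_measurable _ HT R S1 (fun x' : HT => \sum_q G q x') f fG).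
    exact: bounded_measurable_sum.
  rewrite -(Rintegral_finsum mS1' S1fin')//; apply: eq_Rintegral => x' /[1!inE] Sx'.
  by rewrite fG.
rewrite frob_tapp -sumrB; apply: le_trans (ler_norm_sum _ _ _) _.
have E : \sum_(q : I4) (c * (2 * r) * `|x - y| ^- 4 * slip_mass L1 * slip_mass L2) =
    81%:R * (c * (2 * r) * `|x - y| ^- 4) * slip_mass L1 * slip_mass L2.
  by rewrite sumr_const !card_prod !card_ord -[_ *+ _]mulr_natl !mulrA.
rewrite -E; apply: ler_sum => q _.
rewrite (oriented_areaE _ _ LN1') (oriented_areaE _ _ LN2') /G RintegralZl//; last first.
  apply: (bounded_measurable_integrable mS1' S1fin').
  by apply: bounded_measurableM; [exact: bn1|exact: bJ].
set I1 := \int[mu]_(x' in S1) (n1 q x' * J q x').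
have -> : b1 0 q.1.1 * b2 0 q.2.1 * I1 -
    burgers L1 0 q.1.1 * \int[mu]_(x' in S1) slip_normal L1 x' 0 q.1.2 *
      (M (x - y) q.1.1 q.1.2 q.2.1 q.2.2 * (burgers L2 0 q.2.1 *
       \int[mu]_(y' in S2) slip_normal L2 y' 0 q.2.2)) =
    b1 0 q.1.1 * b2 0 q.2.1 * (I1 - F q (x - y) * (\int[mu]_(x' in S1) n1 q x') *
       (\int[mu]_(y' in S2) n2 q y')).
  by rewrite /b1 /b2 /F /n1 /n2; ring.
rewrite !normrM.
have := kernel_double_average c0 (Fc q) erefl r0 xy0 rxy mS1' mS2' S1fin' S2fin'
  S1r S2r (bn1 q.1.2).1 (bn2 q.2.2).1 (n11 q.1.2) (n21 q.2.2).
rewrite -/(n1 q) -/(n2 q) => H.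
have f1 : fine (mu S1) <= fine (mu (slip_surface L1)) by rewrite fine_le// ge0_fin_numE.
have f2 : fine (mu S2) <= fine (mu (slip_surface L2)) by rewrite fine_le// ge0_fin_numE.
set m1 := fine (mu S1) in H f1; set m2 := fine (mu S2) in H f2.
set d := c * (2 * r) * _ in H *.
have d0 : 0 <= d by rewrite !mulr_ge0 ?invr_ge0 ?exprn_ge0.
have m10 : 0 <= m1 by rewrite fine_ge0.
have m20 : 0 <= m2 by rewrite fine_ge0.
have -> : d * slip_mass L1 * slip_mass L2 =
   enorm b1 * enorm b2 * (d * fine (mu (slip_surface L1)) * fine (mu (slip_surface L2))).
  by rewrite /slip_mass; ring.
apply: ler_pM; rewrite ?mulr_ge0//.
  by apply: ler_pM => //; exact: coord_le_enorm.
apply: le_trans H _; apply: ler_pM => //; first by rewrite mulr_ge0.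
by rewrite ler_wpM2l.
Qed.

End Interaction.

(** * Sums over pairs of lattice points *)

Section LatticeReduction.
Variables (R : realType) (v : 'I_3 -> 'rV[R]_3).
Hypothesis vfree : row_free (\matrix_i v i).
Local Notation xi := (lat_pt v).

Lemma latticeE rho x : lattice v rho x <-> exists z, x = rho *: xi z.
Proof.
split => [[nu _ <-]|[z ->]].
  exists (\row_i nu i); congr (_ *: _).
  by apply: eq_bigr => i _; rewrite mxE.
by exists (fun i => z 0 i).
Qed.

Lemma lattice_bounded (Omega : set 'rV[R]_3) rho : bounded_set Omega -> 0 < rho ->
  exists n, forall z, Omega (rho *: xi z) -> (lat_norm z <= n)%N.
Proof.
move=> [B [_ HB]] rho0; have [k k0 kP] := lat_pt_norm_ge vfree.
pose A := `|B| + 1; have BA : B < A by rewrite (le_lt_trans (ler_norm _))// ltrDl.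
have A0 : 0 <= A by rewrite addr_ge0.
exists (Num.truncn (A / (rho * k))) => z Oz.
have [->|z0] := eqVneq z 0; first by rewrite lat_norm0.
have := HB A BA _ Oz => /=; rewrite normrZ gtr0_norm// => zA.
rewrite -ltnS -(ltr_nat R).
have /andP[_] := truncn_itv (divr_ge0 A0 (ltW (mulr_gt0 rho0 k0))).
apply: le_lt_trans; rewrite ler_pdivlMr ?mulr_gt0// mulrC -mulrA.
apply: le_trans zA; rewrite ler_wpM2l ?(ltW rho0)//.
by apply: le_trans (kP _ z0); rewrite ler_wpM2l ?(ltW k0)// ler_nat.
Qed.

Lemma lattice_pairs_sum rho n (Phi : 'rV[R]_3 -> 'rV[R]_3 -> R) : 0 < rho ->
  (forall z w, (n < lat_norm z)%N || (n < lat_norm w)%N ->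
     Phi (rho *: xi z) (rho *: xi w) = 0) ->
  \sum_(p \in lattice_pairs v rho) Phi p.1 p.2 =
  \sum_(z <- box n) \sum_(w <- box n | w != z) Phi (rho *: xi z) (rho *: xi w).
Proof.
move=> rho0 Phi0.
pose g (p : Z3 * Z3) := (rho *: xi p.1, rho *: xi p.2).
have xi_inj z w : rho *: xi z = rho *: xi w -> z = w.
  by move=> /scalerI H; apply: (lat_pt_inj vfree); apply: H; rewrite gt_eqF.
pose s := [seq p <- [seq (z, w) | z <- box n, w <- box n] | p.2 != p.1].
have us : uniq (map g s).
  rewrite map_inj_uniq; last by move=> [z w] [z' w'] [/xi_inj -> /xi_inj ->].
  by rewrite filter_uniq// allpairs_uniq ?box_uniq// => -[z w] [z' w'] _ _ [-> ->].
have -> : \sum_(z <- box n) \sum_(w <- box n | w != z) Phi (rho *: xi z) (rho *: xi w) =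
    \sum_(p <- map g s) Phi p.1 p.2.
  rewrite [RHS]big_map [RHS]big_filter [RHS]big_mkcond big_allpairs /=.
  by apply: eq_bigr => z _; rewrite [LHS]big_mkcond.
rewrite [RHS]fsbig_seq//; apply: esym; apply: fsbig_widen.
  move=> q /= /mapP[[z w]]; rewrite mem_filter /= => /andP[zw _] -> {q}.
  split; [by apply/latticeE; exists z|by apply/latticeE; exists w|].
  by move=> /= /xi_inj wz; rewrite wz eqxx in zw.
move=> [x y] /= [[/latticeE[z /= ez] /latticeE[w /= ew] xy] Hs]; subst x y.
apply: Phi0; rewrite !ltnNge -negb_and; apply/negP => /andP[zn wn]; apply: Hs.
apply/mapP; exists (z, w) => //; rewrite mem_filter /=; apply/andP; split.
  by apply/eqP => wz; apply: xy; rewrite wz.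
by apply/allpairsP; exists (z, w); rewrite !mem_box.
Qed.

Lemma sum_weightV4_shift n z : z \in box n ->
  \sum_(w <- box n) weight R (lat_norm (z - w)) ^- 4 <= 52%:R.
Proof.
rewrite mem_box => zn; apply: le_trans (ball_sum_weightV4 R n.*2).
have us : uniq (map (fun w => z - w) (box n)).
  by rewrite map_inj_uniq ?box_uniq// => w w' /addrI/oppr_inj.
rewrite -(big_map (fun w => z - w) xpredT (fun y => weight R (lat_norm y) ^- 4)).
rewrite [leRHS](bigID (fun y => y \in map (fun w => z - w) (box n))) /=.
rewrite -[leLHS]addr0; apply: lerD; last first.
  by apply: sumr_ge0 => y _; rewrite invr_ge0 exprn_ge0// weight_ge0.
rewrite -[leRHS]big_filter le_eqVlt; apply/orP; left; apply/eqP; apply: perm_big.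
apply: uniq_perm => //; first by rewrite filter_uniq ?box_uniq.
move=> y; rewrite mem_filter andb_idr// => /mapP[w]; rewrite !mem_box => wn ->.
by rewrite -addnn (leq_trans (lat_normB _ _))// leq_add.
Qed.

(** Schur's test: m(z) m(w) is at most the mean of the squares, and |z|^-4 is
    summable over the lattice. *)
Lemma schur_bound : exists2 c, 0 <= c & forall n (m : Z3 -> R),
  (forall z, 0 <= m z) ->
  \sum_(z <- box n) \sum_(w <- box n | w != z) m z * m w * `|xi (z - w)| ^- 4 <=
  c * \sum_(z <- box n) m z ^+ 2.
Proof.
have [k k0 kP] := lat_pt_norm_ge vfree.
exists (k ^- 4 * 52%:R) => [|n m m0]; first by rewrite mulr_ge0 ?invr_ge0 ?exprn_ge0// ltW.
have kV0 : 0 <= k ^- 4 by rewrite invr_ge0 exprn_ge0// ltW.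
pose W y := weight R (lat_norm y) ^- 4.
have W0 y : 0 <= W y by rewrite invr_ge0 exprn_ge0// weight_ge0.
apply: (@le_trans _ _ (\sum_(z <- box n) \sum_(w <- box n)
    (k ^- 4 * (2^-1 * (m z ^+ 2 * W (z - w) + m w ^+ 2 * W (z - w)))))).
  apply: ler_sum => z _; rewrite big_mkcond; apply: ler_sum => w _.
  case: eqVneq => [_|wz] /=.
    by rewrite mulr_ge0// mulr_ge0 ?invr_ge0// addr_ge0// mulr_ge0// exprn_ge0.
  have zw0 : z - w != 0 by rewrite subr_eq0 eq_sym.
  have xW : `|xi (z - w)| ^- 4 <= k ^- 4 * W (z - w).
    have xi0 : 0 < `|xi (z - w)| by rewrite normr_gt0 lat_pt_eq0.
    have kw : 0 < k * weight R (lat_norm (z - w)) by rewrite mulr_gt0 ?weight_gt0.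
    rewrite /W -invfM -exprMn lef_pV2 ?posrE ?exprn_gt0//.
    by rewrite lerXn2r ?nnegrE ?kP// ltW.
  apply: le_trans (ler_wpM2l (mulr_ge0 (m0 z) (m0 w)) xW) _.
  rewrite mulrCA ler_wpM2l// -mulrDl mulrA ler_wpM2r//.
  have := sqr_ge0 (m z - m w); rewrite sqrrB; lra.
have E z : z \in box n -> m z ^+ 2 * (\sum_(w <- box n) W (z - w)) <= m z ^+ 2 * 52%:R.
  by move=> zn; rewrite ler_wpM2l ?exprn_ge0// sum_weightV4_shift.
have -> : \sum_(z <- box n) \sum_(w <- box n)
    (k ^- 4 * (2^-1 * (m z ^+ 2 * W (z - w) + m w ^+ 2 * W (z - w)))) =
   k ^- 4 * \sum_(z <- box n) m z ^+ 2 * (\sum_(w <- box n) W (z - w)).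
  under eq_bigr do (rewrite -mulr_sumr -mulr_sumr big_split /= -mulr_sumr).
  rewrite -mulr_sumr -mulr_sumr big_split /=; congr (_ * _).
  rewrite [X in _ + X]exchange_big /=.
  have -> : \sum_(w <- box n) \sum_(z <- box n) m w ^+ 2 * W (z - w) =
      \sum_(z <- box n) m z ^+ 2 * (\sum_(w <- box n) W (z - w)).
    apply: eq_bigr => w _; rewrite mulr_sumr; apply: eq_bigr => z _.
    by rewrite /W -lat_normN opprB.
  lra.
rewrite -mulrA ler_wpM2l// mulr_sumr big_seq [leRHS]big_seq.
by apply: ler_sum => z zn; rewrite [leRHS]mulrC E.
Qed.

End LatticeReduction.

Section ElasticLatticeKernel.
Variables (R : realType) (v : 'I_3 -> 'rV[R]_3).
Hypothesis vfree : row_free (\matrix_i v i).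
Variables (C : tensor4 R) (K : 'rV[R]_3 -> 'M[R]_3).
Hypothesis CK : green_function C K.
Local Notation xi := (lat_pt v).
Local Notation M := (elastic_kernel C K).
Local Notation I4 := ('I_3 * 'I_3 * ('I_3 * 'I_3))%type.

Let P (q : I4) := partials [:: q.1.2; q.2.2] (fun z => K z q.1.1 q.2.1).

Let elastic_kernelE z i j i' j' : M z i j i' j' = \sum_(q : I4)
  C i j q.1.1 q.1.2 * P q z * C q.2.1 q.2.2 i' j'.
Proof.
rewrite /elastic_kernel pair_bigA /=; under eq_bigr do rewrite pair_bigA /=.
by rewrite pair_bigA.
Qed.

Let P_homog q : smooth_homog 3 (P q).
Proof. by do 2!apply: partial_homog; exact: (green_function_homog CK). Qed.

(** Homogeneity reduces the lattice of spacing rho to the one of spacing 1. *)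
Lemma elastic_kernel_homog (t : R) z i j i' j' : 0 < t -> z != 0 ->
  M (t *: z) i j i' j' = t ^- 3 * M z i j i' j'.
Proof.
move=> t0 z0; rewrite !elastic_kernelE mulr_sumr; apply: eq_bigr => q _.
by rewrite (P_homog q).2//; ring.
Qed.

Lemma elastic_kernel_bilinear : exists2 c, 0 <= c &
  forall i j i' j' n (f g : Z3 -> R),
  `|\sum_(z <- box n) \sum_(w <- box n)
      f z * lat_kernel v (fun x => M x i j i' j') (z - w) * g w| <=
  c * (\sum_(z <- box n) f z ^+ 2 + \sum_(z <- box n) g z ^+ 2).
Proof.
have /choice[c cP] : forall q : I4, exists c, 0 <= c /\
    forall n (f g : Z3 -> R),
    `|\sum_(z <- box n) \sum_(w <- box n) f z * lat_kernel v (P q) (z - w) * g w| <=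
    c * (\sum_(z <- box n) f z ^+ 2 + \sum_(z <- box n) g z ^+ 2).
  move=> q.
  have [c [G cG]] := partial_cz_kernel vfree q.1.2
    (partial_homog q.2.2 (green_function_homog CK q.1.1 q.2.1)).
  have c0 : 0 <= c.
    have := le_trans (normr_ge0 _) (cz_size cG 0).
    by rewrite lat_norm0 /weight expr1n invr1 mulr1.
  exists (350%:R * c); split; first exact: mulr_ge0 (ler0n _ _) c0.
  by move=> n f g; exact: cz_bilinear_bound cG.
pose s : R := \sum_(p : I4) `|C p.1.1 p.1.2 p.2.1 p.2.2|.
have Cs i j k l : `|C i j k l| <= s.
  by rewrite /s (bigD1 (i, j, (k, l)))//= lerDl sumr_ge0.
have s0 : 0 <= s by rewrite sumr_ge0.
clearbody s; exists (\sum_(q : I4) s * s * c q) => [|i j i' j' n f g].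
  by apply: sumr_ge0 => q _; rewrite !mulr_ge0//; have [] := cP q.
have -> : \sum_(z <- box n) \sum_(w <- box n)
      f z * lat_kernel v (fun x => M x i j i' j') (z - w) * g w =
    \sum_(q : I4) (C i j q.1.1 q.1.2 * C q.2.1 q.2.2 i' j') *
     \sum_(z <- box n) \sum_(w <- box n) f z * lat_kernel v (P q) (z - w) * g w.
  under [RHS]eq_bigr do rewrite mulr_sumr.
  rewrite [RHS]exchange_big; apply: eq_bigr => z _ /=.
  under [RHS]eq_bigr do rewrite mulr_sumr.
  rewrite [RHS]exchange_big; apply: eq_bigr => w _ /=; rewrite /lat_kernel.
  case: eqP => [_|_].
    by rewrite mulr0 mul0r big1// => q _; rewrite !(mulr0, mul0r).
  rewrite elastic_kernelE mulr_sumr mulr_suml; apply: eq_bigr => q _; ring.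
apply: le_trans (ler_norm_sum _ _ _) _; rewrite mulr_suml.
apply: ler_sum => q _; have [cq0 /(_ n f g) cqP] := cP q.
rewrite normrM -[leRHS]mulrA; apply: ler_pM => //.
by rewrite normrM; apply: ler_pM.
Qed.

End ElasticLatticeKernel.

(** * Arrays of dislocation loops *)

Section DislocationArray.
Variables (R : realType) (v : 'I_3 -> 'rV[R]_3) (Omega : set 'rV[R]_3).
Hypotheses (vfree : row_free (\matrix_i v i)) (bO : bounded_set Omega).
Variables (C : tensor4 R) (K : 'rV[R]_3 -> 'M[R]_3).
Hypothesis CK : green_function C K.
Variable D : R -> 'rV[R]_3 -> dislocation_loop R.
Hypothesis arrD : forall r : R, 0 < r -> dislocation_array v Omega r (D r).
Local Notation H2 := (@hausdorff R 3 2).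
Local Notation HT := (caratheodory_type H2).
Local Notation mu := (@Haus R 3 2).
Local Notation xi := (lat_pt v).
Local Notation M := (elastic_kernel C K).

Definition lat_loop rho (z : Z3) := D rho (rho *: xi z).

Let in_lattice rho z : lattice v rho (rho *: xi z).
Proof. by apply/latticeE; exists z. Qed.

Let no_loop rho z : 0 < rho -> ~ Omega (rho *: xi z) ->
  slip_surface (lat_loop rho z) = set0.
Proof. by move=> rho0 Oz; have [_ /(_ (rho *: xi z))[]] := arrD rho0. Qed.

Let is_loop rho z : 0 < rho -> Omega (rho *: xi z) ->
  is_dislocation_loop (lat_loop rho z).
Proof. by move=> rho0 Oz; have [H _] := arrD rho0; apply: H; split. Qed.

Let slip_finite rho z : 0 < rho ->
  measurable (slip_surface (lat_loop rho z) : set HT) /\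
  (mu (slip_surface (lat_loop rho z)) < +oo)%E.
Proof.
move=> rho0; have [Oz|Oz] := pselect (Omega (rho *: xi z)).
  by have [_ [[mS Sfin _] _] _] := is_loop rho0 Oz.
by rewrite no_loop// measure0.
Qed.

Let no_area rho z : 0 < rho -> ~ Omega (rho *: xi z) ->
  oriented_area (lat_loop rho z) = 0.
Proof.
move=> rho0 Oz; apply/matrixP => i j.
by rewrite mxE no_loop// Rintegral_set0 mxE.
Qed.

Let interaction_set0 L L' : slip_surface L = set0 \/ slip_surface L' = set0 ->
  interaction M L L' = 0.
Proof.
rewrite /interaction => -[->|->]; first by rewrite Rintegral_set0.
under eq_Rintegral do rewrite Rintegral_set0.
have [mS|mS] := pselect (measurable (slip_surface L : set HT)).
  by rewrite Rintegral_cst// mul0r.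
by rewrite /Rintegral integral0.
Qed.

(** Loops sit in the bounded set Omega, which meets the lattice in finitely many
    points; the box depends on rho, but no estimate depends on the box. *)
Lemma array_sums rho : 0 < rho -> exists n,
  [/\ forall z, Omega (rho *: xi z) -> (lat_norm z <= n)%N,
      total_interaction v M rho (D rho) =
        2^-1 * \sum_(z <- box n) \sum_(w <- box n | w != z)
          interaction M (lat_loop rho z) (lat_loop rho w)
    & discrete_interaction v M rho (fun x => oriented_area (D rho x)) =
        2^-1 * \sum_(z <- box n) \sum_(w <- box n | w != z)
          frob (oriented_area (lat_loop rho z))
            (tapp (M (rho *: xi z - rho *: xi w)) (oriented_area (lat_loop rho w)))].
Proof.
move=> rho0; have [n nP] := lattice_bounded vfree bO rho0.
have out z : (n < lat_norm z)%N -> ~ Omega (rho *: xi z).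
  by move=> nz /nP; rewrite leqNgt nz.
exists n; split => //; congr (_ * _).
- apply: etrans (@lattice_pairs_sum _ _ vfree rho n
    (fun x y => interaction M (D rho x) (D rho y)) rho0 _) _ => //.
  move=> z w /orP[/out Oz|/out Ow]; apply: interaction_set0.
    by left; exact: no_loop.
  by right; exact: no_loop.
- apply: etrans (@lattice_pairs_sum _ _ vfree rho n (fun x y =>
    frob (oriented_area (D rho x)) (tapp (M (x - y)) (oriented_area (D rho y)))) rho0 _) _ => //.
  move=> z w zw; rewrite frob_tapp big1// => q _.
  case/orP: zw => /out H; have := no_area rho0 H; rewrite /lat_loop => ->.
    by rewrite [X in X * _]mxE mul0r.
  by rewrite [X in _ * (_ * X)]mxE !mulr0.
Qed.

Hypothesis summable : square_summable_slip v D.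

(** The summability assumption in terms of finite sums of real numbers. *)
Lemma slip_mass_square_sum : exists2 A, 0 <= A & forall rho n, 0 < rho ->
  \sum_(z <- box n) slip_mass (lat_loop rho z) ^+ 2 <= A * rho ^+ 3.
Proof.
have := summable; rewrite /square_summable_slip; set e := ereal_sup _ => efin.
pose A := fine e.
have esE rho n : 0 < rho ->
    ((\sum_(z <- box n) rho ^- 3 * slip_mass (lat_loop rho z) ^+ 2)%:E <= e)%E.
  move=> rho0; pose t x := ((rho ^- 3)%:E * (\int[mu]_(x0 in slip_surface (D rho x))
      (enorm (burgers (D rho x)))%:E) ^+ 2)%E.
  apply: (@le_trans _ _ (\esum_(x in lattice v rho) t x)); last first.
    by apply: ereal_sup_ubound; exists rho.
  have us : uniq (map (fun z => rho *: xi z) (box n)).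
    rewrite map_inj_uniq ?box_uniq// => z w /scalerI H.
    by apply: (lat_pt_inj vfree); apply: H; rewrite gt_eqF.
  apply: esum_ge; exists [set` map (fun z => rho *: xi z) (box n)].
    split; first exact: finite_seq.
    by move=> x /= /mapP[z _ ->]; exact: in_lattice.
  rewrite -fsbig_seq// [leRHS]big_map -sumEFin; apply: lee_sum => z _.
  have [mS Sfin] := slip_finite z rho0.
  rewrite /t integral_cst// -[mu _]fineK ?ge0_fin_numE//.
have e0 : (0 <= e)%E.
  by apply: le_trans (esE 1 0%N ltr01); rewrite lee_fin sumr_ge0// => z _;
    rewrite mulr_ge0 ?invr_ge0 ?exprn_ge0// slip_mass_ge0.
have eE : e = A%:E by rewrite fineK// ge0_fin_numE.
exists A => [|rho n rho0]; first by rewrite fine_ge0.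
have := esE rho n rho0; rewrite eE lee_fin -mulr_sumr mulrC ler_pdivrMr//.
by rewrite exprn_gt0.
Qed.

Let area_le rho z i j : 0 < rho ->
  `|oriented_area (lat_loop rho z) i j| <= slip_mass (lat_loop rho z).
Proof.
move=> rho0; have [Oz|Oz] := pselect (Omega (rho *: xi z)); last first.
  by rewrite no_area// mxE normr0 slip_mass_ge0.
have [N LN] := loop_regular (is_loop rho0 Oz).
exact: oriented_area_le LN.
Qed.

Let pair_diff rho z w : rho *: xi z - rho *: xi w = rho *: xi (z - w).
Proof. by rewrite lat_ptB scalerBr. Qed.

(** Scaling gives rho^-3 and the sum of squares of the oriented areas is O(rho^3),
    as each of them is bounded by the slip mass. *)
Lemma discrete_interaction_bounded : exists B, forall rho, 0 < rho ->
  `|discrete_interaction v M rho (fun x => oriented_area (D rho x))| <= B.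
Proof.
have [A A0 AP] := slip_mass_square_sum.
have [c c0 cP] := elastic_kernel_bilinear vfree CK.
exists (2^-1 * \sum_(q : 'I_3 * 'I_3 * ('I_3 * 'I_3)) c * (A + A)) => rho rho0.
have [n [_ _ ->]] := array_sums rho0.
pose f i j z := oriented_area (lat_loop rho z) i j.
have f2 i j : \sum_(z <- box n) f i j z ^+ 2 <= A * rho ^+ 3.
  apply: le_trans (AP rho n rho0); apply: ler_sum => z _.
  by rewrite -(real_normK (num_real (f i j z))) lerXn2r ?nnegrE ?slip_mass_ge0// area_le.
have -> : \sum_(z <- box n) \sum_(w <- box n | w != z)
    frob (oriented_area (lat_loop rho z))
      (tapp (M (rho *: xi z - rho *: xi w)) (oriented_area (lat_loop rho w))) =
  \sum_(q : 'I_3 * 'I_3 * ('I_3 * 'I_3)) rho ^- 3 *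
    \sum_(z <- box n) \sum_(w <- box n) f q.1.1 q.1.2 z *
      lat_kernel v (fun x => M x q.1.1 q.1.2 q.2.1 q.2.2) (z - w) *
      f q.2.1 q.2.2 w.
  under [RHS]eq_bigr do rewrite mulr_sumr.
  rewrite [RHS]exchange_big; apply: eq_bigr => z _ /=.
  under [RHS]eq_bigr do rewrite mulr_sumr.
  rewrite [RHS]exchange_big [LHS]big_mkcond; apply: eq_bigr => w _ /=.
  rewrite /lat_kernel subr_eq0 eq_sym; case: eqP => [_|/eqP zw] /=.
    by rewrite big1// => q _; rewrite !(mulr0, mul0r).
  rewrite frob_tapp pair_diff; apply: eq_bigr => q _.
  rewrite elastic_kernel_homog//; last by rewrite lat_pt_eq0// subr_eq0.
  by rewrite -/(f _ _ z) -/(f _ _ w); ring.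
rewrite normrM ger0_norm ?invr_ge0// ler_wpM2l ?invr_ge0//.
apply: le_trans (ler_norm_sum _ _ _) _; apply: ler_sum => q _.
have r3 : 0 < rho ^+ 3 by rewrite exprn_gt0.
rewrite normrM ger0_norm ?invr_ge0 ?(ltW r3)// mulrC ler_pdivrMr//.
apply: le_trans (cP _ _ _ _ n _ _) _.
by rewrite -mulrA ler_wpM2l// mulrDl lerD.
Qed.

(** The two energies differ by at most a multiple of r(rho) / rho: for each pair
    of loops the kernel varies by r |x - y|^-4 on the slip surfaces, and this
    kernel is bounded on l^2 of the lattice. *)
Lemma energies_close : exists c e0, [/\ 0 <= c, 0 < e0 &
  forall rho e, 0 < rho -> 0 <= e -> e <= e0 ->
    (slip_radius v D rho <= (e * rho)%:E)%E ->
  `|total_interaction v M rho (D rho) -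
    discrete_interaction v M rho (fun x => oriented_area (D rho x))| <= c * e].
Proof.
have [A A0 AP] := slip_mass_square_sum.
have [k k0 kP] := lat_pt_norm_ge vfree.
have [c c0 cP] := elastic_kernel_increment CK.
have [s s0 sP] := schur_bound vfree.
(* k bounds the distances in the lattice of spacing 1 from below, so that the slip
   radius is then at most an eighth of the distance of any two loops *)
exists (81%:R * c * s * A), (k / 8%:R); split => [||rho e rho0 e_ge0 ek rad].
- by rewrite !mulr_ge0.
- by rewrite divr_gt0.
have [n [nP -> ->]] := array_sums rho0.
have rV3 : 0 <= rho ^- 3 by rewrite invr_ge0 exprn_ge0// ltW.
pose m z := slip_mass (lat_loop rho z).
have m0 z : 0 <= m z by exact: slip_mass_ge0.
have K0 : 0 <= 162%:R * c * e * rho ^- 3.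
  by apply: mulr_ge0 rV3; apply: mulr_ge0 e_ge0; exact: mulr_ge0 (ler0n _ _) c0.
have pair_close z w : w != z ->
  `|interaction M (lat_loop rho z) (lat_loop rho w) -
    frob (oriented_area (lat_loop rho z))
      (tapp (M (rho *: xi z - rho *: xi w)) (oriented_area (lat_loop rho w)))| <=
  (162%:R * c * e * rho ^- 3) * (m z * m w * `|xi (z - w)| ^- 4).
  move=> wz; have rhs0 : 0 <= (162%:R * c * e * rho ^- 3) * (m z * m w * `|xi (z - w)| ^- 4).
    by apply: mulr_ge0 K0 (mulr_ge0 (mulr_ge0 (m0 z) (m0 w)) _); rewrite invr_ge0 exprn_ge0.
  have [Oz|Oz] := pselect (Omega (rho *: xi z)); last first.
    rewrite interaction_set0; last by left; exact: no_loop.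
    rewrite no_area// frob_tapp big1 ?subr0 ?normr0// => q _.
    by rewrite [X in X * _]mxE mul0r.
  have [Ow|Ow] := pselect (Omega (rho *: xi w)); last first.
    rewrite interaction_set0; last by right; exact: no_loop.
    rewrite (no_area rho0 Ow) frob_tapp big1 ?subr0 ?normr0// => q _.
    by rewrite [X in _ * (_ * X)]mxE !mulr0.
  have loc u : Omega (rho *: xi u) ->
      exists N, localized (lat_loop rho u) (rho *: xi u) (e * rho) N.
    move=> Ou; apply: loop_localized; first exact: is_loop.
    by apply: le_trans rad; apply: ereal_sup_ubound; exists (rho *: xi u).
  have [N1 LN1] := loc z Oz; have [N2 LN2] := loc w Ow.
  have zw0 : z - w != 0 by rewrite subr_eq0 eq_sym.
  have x0 : rho *: xi z - rho *: xi w != 0.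
    by rewrite pair_diff scaler_eq0 negb_or gt_eqF// lat_pt_eq0.
  have far : 8%:R * (e * rho) <= `|rho *: xi z - rho *: xi w|.
    rewrite pair_diff normrZ gtr0_norm// mulrA mulrC ler_wpM2l ?(ltW rho0)//.
    apply: le_trans (kP _ zw0); apply: (@le_trans _ _ k).
      by move: ek; lra.
    by rewrite ler_peMr ?(ltW k0)// weight_ge1.
  have er0 : 0 <= e * rho by rewrite mulr_ge0// ltW.
  apply: le_trans (interaction_near_point c0 er0 cP x0 far LN1 LN2) _.
  rewrite -/(m z) -/(m w) pair_diff normrZ gtr0_norm//.
  rewrite le_eqVlt; apply/orP; left; apply/eqP.
  have : `|xi (z - w)| != 0 by rewrite normr_eq0 lat_pt_eq0.
  move: (m z) (m w) `|xi (z - w)| => m1 m2 t t0.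
  by field; rewrite t0 gt_eqF.
rewrite -mulrBr normrM ger0_norm ?invr_ge0// -sumrB.
apply: (@le_trans _ _ (2^-1 * (162%:R * c * e * rho ^- 3 * (s * (A * rho ^+ 3))))); last first.
  rewrite le_eqVlt; apply/orP; left; apply/eqP.
  by field; rewrite gt_eqF.
rewrite ler_wpM2l ?invr_ge0//; apply: le_trans (ler_norm_sum _ _ _) _.
apply: (@le_trans _ _ (\sum_(z <- box n) \sum_(w <- box n | w != z)
    (162%:R * c * e * rho ^- 3) * (m z * m w * `|xi (z - w)| ^- 4))).
  apply: ler_sum => z _; rewrite -sumrB; apply: le_trans (ler_norm_sum _ _ _) _.
  by apply: ler_sum => w wz; exact: pair_close.
under eq_bigr do rewrite -mulr_sumr.
rewrite -mulr_sumr ler_wpM2l//.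
by apply: le_trans (sP n m m0) _; rewrite ler_wpM2l// AP.
Qed.

End DislocationArray.

(** * Convergence along a subsequence *)

Theorem proposition3p1 (R : realType)
    (C : tensor4 R) (K : 'rV[R]_3 -> 'M[R]_3)
    (v : 'I_3 -> 'rV[R]_3) (Omega : set 'rV[R]_3)
    (D : R -> 'rV[R]_3 -> dislocation_loop R) (rho : nat -> R) :
  elasticity_tensor C -> green_function C K ->
  lattice_basis v -> open Omega -> bounded_set Omega ->
  (forall r : R, 0 < r -> dislocation_array v Omega r (D r)) ->
  square_summable_slip v D -> small_slip_radius v D ->
  (forall k, 0 < rho k) -> rho k @[k --> \oo] --> 0 ->
  exists2 phi : nat -> nat, {homo phi : m n / (m < n)%N} &
    exists l : R,
      total_interaction v (elastic_kernel C K) (rho (phi k)) (D (rho (phi k)))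
        @[k --> \oo] --> l /\
      discrete_interaction v (elastic_kernel C K) (rho (phi k))
        (fun x => oriented_area (D (rho (phi k)) x))
        @[k --> \oo] --> l.
Proof.
move=> _ CK [vfree _] _ bO arrD summable smallr rho0 rho_cvg.
pose T k := total_interaction v (elastic_kernel C K) (rho k) (D (rho k)).
pose d k := discrete_interaction v (elastic_kernel C K) (rho k)
  (fun x => oriented_area (D (rho k) x)).
have [B dB] := discrete_interaction_bounded vfree bO CK arrD summable.
have bd : bounded_fun (d : R^nat).
  exists B; split => [|x Bx k _ /=]; first exact: num_real.
  exact: le_trans (dB _ (rho0 k)) (ltW Bx).
have [phi phi_mono cvg_d] := bolzano_weierstrass bd.
have phi_homo : {homo phi : m n / (m < n)%N}.
  by move=> m n mn; rewrite ltnNge -leEnat phi_mono -ltnNge.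
have phi_ge k : (k <= phi k)%N.
  by elim: k => // k IH; apply: leq_ltn_trans IH _; exact: phi_homo.
have Td0 : (fun k => T k - d k) k @[k --> \oo] --> 0.
  have [c [e0 [c0 e0_gt0 close]]] := energies_close vfree bO CK arrD summable.
  apply/cvgrPdist_le => e e_gt0; pose e1 := Num.min e0 (e / (c + 1)).
  have c1 : 0 < c + 1 by rewrite ltr_wpDl.
  have e1_gt0 : 0 < e1 by rewrite lt_min e0_gt0 divr_gt0.
  have [delta /= delta0 deltaP] := smallr e1 e1_gt0.
  have : \forall k \near \oo, `|0 - rho k| < delta.
    by move/cvgrPdist_lt : rho_cvg; apply.
  apply: filterS => k kd; rewrite sub0r normrN.
  have rad := deltaP (rho k) kd (rho0 k).
  have e1_ge0 := ltW e1_gt0.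
  apply: le_trans (close _ _ (rho0 k) e1_ge0 _ rad) _; first by rewrite ge_min lexx.
  apply: (@le_trans _ _ ((c + 1) * e1)); first by rewrite ler_wpM2r// lerDl.
  by rewrite mulrC -ler_pdivlMr// ge_min lexx orbT.
(* the vanishing difference of the energies is added to the limit of the discrete
   one *)
exists phi => //; exists (lim (d \o phi @ \oo)); split; last exact: cvg_d.
have Tdphi0 : T (phi k) - d (phi k) @[k --> \oo] --> 0.
  apply: (@cvg_comp _ _ _ phi (fun k => T k - d k) \oo \oo _ _ Td0).
  move=> P [N _ NP]; exists N => // k /= Nk; apply: NP => /=.
  exact: leq_trans Nk (phi_ge k).
rewrite -[lim _]add0r.
have -> : (fun k => total_interaction v (elastic_kernel C K) (rho (phi k))
    (D (rho (phi k)))) = (fun k => (T (phi k) - d (phi k)) + d (phi k)).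
  by apply/funext => k; rewrite subrK.
by apply: cvgD => //; exact: cvg_d.
Qed.
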